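(* Let $(X,T)$ be a topological dynamical system with a metric $d$ satisfying weak tame growth of covering numbers. Then for every $\delta\in(0,1)$, $$\begin{aligned}\overline{\mathrm{mdim}}_{FK}(T,X,d)&=\limsup_{\epsilon\to0}\frac{1}{\log\frac1\epsilon}\sup_{\mu\in E(X,T)}h_{\mu,FK}(T,\epsilon,\delta)\\&=\limsup_{\epsilon\to0}\frac{1}{\log\frac1\epsilon}\sup_{\mu\in M(X,T)}h_{\mu,FK}(T,\epsilon,\delta)\\&=\limsup_{\epsilon\to0}\frac{1}{\log\frac1\epsilon}\sup_{\mu\in M(X)}h_{\mu,FK}(T,\epsilon,\delta).\end{aligned}$$
   Context: A topological dynamical system $(X,T)$ with a metric $d$ is a non-empty compact metric space $(X,d)$ together with a homeomorphism $T:X\to X$. $M(X)$, $M(X,T)$, $E(X,T)$ denote the sets of Borel probability measures on $X$, of $T$-invariant Borel probability measures on $X$, and of $T$-invariant ergodic Borel probability measures on $X$, respectively. All limits superior take values in $[0,\infty]$. **Growth condition.** $\#(X,d,\epsilon)$ is the smallest number of open balls $B_d(x,\epsilon)=\{y\in X:d(x,y)<\epsilon\}$, $x\in X$, needed to cover $X$. $(X,d)$ has weak tame growth of covering numbers if $\lim_{\epsilon\to0}\epsilon\log\#(X,d,\epsilon)=0$. **Feldman–Katok (FK) metric.** For $x,y\in X$, $n\ge 1$, $\delta'>0$, an $(n,\delta')$-match of $x$ and $y$ is an order preserving bijection $\pi:D(\pi)\to R(\pi)$ (i.e. $\pi(i)<\pi(j)$ whenever $i<j$) with $D(\pi),R(\pi)\subset\{0,1,\dots,n-1\}$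 and $d(T^{i}x,T^{\pi(i)}y)<\delta'$ for every $i\in D(\pi)$. Let $|\pi|$ be the cardinality of $D(\pi)$, and set $$\bar f_{n,\delta'}(x,y)=1-\tfrac1n\max\{|\pi|:\pi\text{ is an }(n,\delta')\text{-match of }x\text{ and }y\},\qquad d_{FK_n}(x,y)=\inf\{\delta'>0:\bar f_{n,\delta'}(x,y)<\delta'\}.$$ Let $B_{FK_n}(x,\epsilon)=\{y\in X:d_{FK_n}(x,y)<\epsilon\}$. **FK upper metric mean dimension.** Let $r_{FK}(T,X,n,d,\epsilon)$ be the smallest cardinality of a set $E\subset X$ such that for every $x\in X$ there is $y\in E$ with $d_{FK_n}(x,y)<\epsilon$. Put $r_{FK}(T,X,d,\epsilon)=\limsup_{n\to\infty}\frac1n\log r_{FK}(T,X,n,d,\epsilon)$ and $$\overline{\mathrm{mdim}}_{FK}(T,X,d)=\limsup_{\epsilon\to0}\frac{r_{FK}(T,X,d,\epsilon)}{\log\frac1\epsilon}.$$ **FK Katok $\epsilon$-entropy.** For $\mu\in M(X)$, $\epsilon>0$, $n\ge1$, $\delta\in(0,1)$, let $$R_{\mu,FK}(T,n,\delta,\epsilon)=\min\Big\{\#E: E\subset X\text{ and }\mu\Big(\bigcup_{x\in E}B_{FK_n}(x,\epsilon)\Big)>1-\delta\Big\},\qquad h_{\mu,FK}(T,\epsilon,\delta)=\limsup_{n\to\infty}\frac1n\log R_{\mu,FK}(T,n,\delta,\epsilon).$$ *)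

(* Defs.v *)
From HB Require Import structures.
From mathcomp Require Import all_boot all_order all_algebra.
From mathcomp Require Import all_classical all_reals all_analysis.

Set Implicit Arguments.
Unset Strict Implicit.
Unset Printing Implicit Defensive.

Import Order.TTheory GRing.Theory Num.Theory.
Import numFieldNormedType.Exports.

Local Open Scope classical_set_scope.
Local Open Scope ring_scope.

(* Pointedness encodes non-emptiness; the library needs it to put a
   measurable structure on the space. *)
#[short(type="pmetricType")]
HB.structure Definition PMetric (K : numDomainType) :=
  {M of Metric K M & Pointed M}.

Notation borelType X := (g_sigma_algebraType (@open X)).

Definition homeomorphism {X : topologicalType} (T : X -> X) : Prop :=
  continuous T /\
  exists T' : X -> X, [/\ cancel T T', cancel T' T & continuous T'].

Section counting_numbers.
Context {R : realType} {X : choiceType}.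

(* [counting] is +oo on infinite sets, so this is the smallest cardinality of
   a set in the family F, and +oo when F contains no finite set. *)
Definition min_card (F : set (set X)) : \bar R :=
  ereal_inf [set counting E | E in F].

End counting_numbers.

Section covering_numbers.
Context {R : realType} (X : pmetricType R).

Definition covering_number (eps : R) : \bar R :=
  min_card [set E : set X | \bigcup_(x in E) ball x eps = [set: X]].

Definition weak_tame_growth : Prop :=
  (eps%:E * lne (covering_number eps))%E @[eps --> 0^'+] --> 0%E.

End covering_numbers.

Section Feldman_Katok.
Context {R : realType} {X : pmetricType R} (T : X -> X).
Implicit Types (x y : X) (n : nat) (eps delta : R).

(* A match is encoded by its domain D and a function whose restriction to D is
   strictly increasing; it is then a bijection from D onto its image, and the
   values of p outside D are irrelevant. *)
Definition FK_match n delta x y (D : {set 'I_n}) (p : {ffun 'I_n -> 'I_n}) :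
    bool :=
  [forall i in D, forall j in D, (i < j)%N ==> (p i < p j)%N] &&
  [forall i in D, mdist (iter i T x) (iter (p i) T y) < delta].

Definition FK_max_match n delta x y : nat :=
  \max_(Dp : {set 'I_n} * {ffun 'I_n -> 'I_n}
       | FK_match delta x y Dp.1 Dp.2) #|Dp.1|.

Definition FK_fbar n delta x y : R :=
  1 - n%:R^-1 * (FK_max_match n delta x y)%:R.

Definition FK_dist n x y : R :=
  inf [set delta | 0 < delta /\ FK_fbar n delta x y < delta].

Definition FK_ball n x eps : set X := [set y | FK_dist n x y < eps].

Definition FK_spanning_number n eps : \bar R :=
  min_card [set E : set X | forall x, exists2 y, E y & FK_dist n x y < eps].

Definition FK_spanning_rate eps : \bar R :=
  limn_esup (fun n => n%:R^-1%:E * lne (FK_spanning_number n eps))%E.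

(* limsup, as eps decreases to 0, of f eps / log (1 / eps) *)
Definition log_scale_limsup (f : R -> \bar R) : \bar R :=
  limf_esup (fun eps => (ln eps^-1)^-1%:E * f eps)%E 0^'+.

Definition FK_upper_mdim : \bar R := log_scale_limsup FK_spanning_rate.

Implicit Type mu : probability (borelType X) R.

Definition FK_Katok_number mu n delta eps : \bar R :=
  min_card [set E : set X |
    ((1 - delta)%:E < mu (\bigcup_(x in E) FK_ball n x eps))%E].

Definition FK_Katok_entropy mu eps delta : \bar R :=
  limn_esup (fun n => n%:R^-1%:E * lne (FK_Katok_number mu n delta eps))%E.

Definition invariant_measure mu : Prop :=
  forall A : set (borelType X), measurable A -> mu (T @^-1` A) = mu A.

Definition ergodic_measure mu : Prop :=
  invariant_measure mu /\
  forall A : set (borelType X), measurable A -> T @^-1` A = A ->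
    mu A = 0%E \/ mu A = 1%E.

Definition FK_Katok_mdim (M : set (probability (borelType X) R)) delta :
    \bar R :=
  log_scale_limsup
    (fun eps => ereal_sup [set FK_Katok_entropy mu eps delta | mu in M]).

End Feldman_Katok.

(* Main.v *)
From HB Require Import structures.
Require Import Defs.
From mathcomp Require Import all_boot all_order all_algebra finmap ring lra.
From mathcomp Require Import all_classical all_reals all_analysis.
From mathcomp Require Import measurable_realfun.

(* The Katok numbers of a measure are at most the spanning numbers of the whole
   space, so only the bound of the mean dimension by ergodic measures matters;
   there a bounded additive error on the exponential rates is harmless, since
   they are divided by log (1 / eps).
   Fix an eps-net of cardinality q. A match leaves at most eps * n indices
   unmatched, so an FK ball of radius eps is covered by 4^n q^(eps n) words of
   length n over the net, and q^eps stays bounded by tame growth. Let mu be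
   ergodic with Katok entropy below h. By ergodicity almost every point lies on
   the forward orbit, at bounded distance, of a point coded by e^(n (h + O(1)))
   words for some large n; hence, outside a set of small measure, orbits follow
   words of a finite codebook, depending on mu, with Kraft sum at most 1/2. Long
   blocks tiled by some codebook, where the codebook is part of the description,
   are at most e^(L (h + O(1))) in number, uniformly in mu. If the orbits of
   length N in X could not, for large N, all be tiled by such blocks up to a
   small density of errors, empirical measures would accumulate at an invariant
   measure charging the closed set K of points that start no block, and a
   maximality argument yields an ergodic measure charging K, which is absurd. So
   the spanning numbers are at most e^(N (h + O(1))). *)

Set Implicit Arguments.
Unset Strict Implicit.
Unset Printing Implicit Defensive.

Import Order.TTheory GRing.Theory Num.Theory.
Import numFieldNormedType.Exports.

Local Open Scope classical_set_scope.
Local Open Scope ring_scope.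

(** * Measures from contents on closed sets *)

Section closed_contents.
Context {R : realType} {X : pmetricType R}.
Implicit Types (m : set X -> R) (A C D U V : set X).

(** A normalized content in the sense of Halmos. [inner_content] and [outer_content] are the two
    steps that turn it into an outer measure, first on open sets and then on all sets. *)
Definition closed_content m : Prop :=
  [/\ forall C D, closed C -> closed D -> C `<=` D -> m C <= m D,
      forall C D, closed C -> closed D -> m (C `|` D) <= m C + m D,
      forall C D, closed C -> closed D -> C `&` D = set0 ->
        m C + m D <= m (C `|` D) &
      m setT = 1].

Definition inner_content m U : \bar R :=
  ereal_sup [set (m C)%:E | C in [set C | closed C /\ C `<=` U]].

Definition outer_content m A : \bar R :=
  ereal_inf [set inner_content m U | U in [set U | open U /\ A `<=` U]].

Hypothesis cptX : compact [set: X].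

(** Normality separates [C \ U] from [C \ V] by disjoint open sets; removing each of them from [C]
    gives the two pieces. *)
Lemma closed_shrink C U V : closed C -> open U -> open V -> C `<=` U `|` V ->
  exists C1 C2, [/\ closed C1, closed C2, C1 `<=` U, C2 `<=` V & C = C1 `|` C2].
Proof.
move=> cC oU oV CUV.
have /(normal_openP (R := R)) nX : normal_space X := pseudometric_normal.
have [|||A [B [oA oB CA CB AB]]] := nX (C `\` U) (C `\` V).
- by rewrite setDE; apply: closedI => //; apply: open_closedC.
- by rewrite setDE; apply: closedI => //; apply: open_closedC.
- by rewrite -subset0 => x [[Cx nUx] [_ nVx]]; case: (CUV x Cx).
exists (C `\` A), (C `\` B); split.
- by rewrite setDE; apply: closedI => //; apply: open_closedC.
- by rewrite setDE; apply: closedI => //; apply: open_closedC.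
- by move=> x [Cx nAx]; apply: contrapT => nUx; apply: nAx; exact: CA.
- by move=> x [Cx nBx]; apply: contrapT => nVx; apply: nBx; exact: CB.
- by rewrite -setDIr AB setD0.
Qed.

Variable m : set X -> R.
Hypothesis mP : closed_content m.

Let mS C D : closed C -> closed D -> C `<=` D -> m C <= m D.
Proof. by case: mP => + _ _ _; exact. Qed.

Let mU C D : closed C -> closed D -> m (C `|` D) <= m C + m D.
Proof. by case: mP => _ + _ _; exact. Qed.

Let mD C D : closed C -> closed D -> C `&` D = set0 ->
  m C + m D <= m (C `|` D).
Proof. by case: mP => _ _ + _; exact. Qed.

Lemma closed_content0 : m set0 = 0.
Proof.
apply/eqP; rewrite eq_le; apply/andP; split.
  have := mD closed0 closed0 (set0I _).
  by rewrite setUid gerDl.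
have := mU closed0 closed0.
by rewrite setUid lerDl.
Qed.

Lemma closed_content_ge0 C : closed C -> 0 <= m C.
Proof. by move=> cC; rewrite -closed_content0; apply: mS => //; exact: closed0. Qed.

Local Open Scope ereal_scope.

Lemma inner_content_ge C U : closed C -> C `<=` U ->
  (m C)%:E <= inner_content m U.
Proof. by move=> cC CU; apply: ereal_sup_ubound; exists C. Qed.

Lemma inner_content_ge0 U : 0 <= inner_content m U.
Proof.
apply: le_trans (inner_content_ge closed0 (@sub0set _ U)).
by rewrite closed_content0.
Qed.

Lemma inner_content_le1 U : inner_content m U <= 1.
Proof.
apply: ge_ereal_sup => _ [C [cC _] <-]; rewrite lee_fin.
have [_ _ _ <-] := mP.
exact: mS.
Qed.

Lemma le_inner_content U V : U `<=` V -> inner_content m U <= inner_content m V.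
Proof.
move=> UV; apply: ge_ereal_sup => _ [C [cC CU] <-].
by apply: inner_content_ge => //; apply: subset_trans UV.
Qed.

Lemma inner_content0 : inner_content m set0 = 0.
Proof.
apply/eqP; rewrite eq_le inner_content_ge0 andbT.
apply: ge_ereal_sup => _ [C [cC +] <-].
by rewrite subset0 => ->; rewrite closed_content0.
Qed.

Lemma inner_content_setU U V : open U -> open V ->
  inner_content m (U `|` V) <= inner_content m U + inner_content m V.
Proof.
move=> oU oV; apply: ge_ereal_sup => _ [C [cC CUV] <-].
have [C1 [C2 [cC1 cC2 C1U C2V ->]]] := closed_shrink cC oU oV CUV.
apply: (@le_trans _ _ ((m C1)%:E + (m C2)%:E)); first by rewrite -EFinD lee_fin mU.
by apply: leeD; exact: inner_content_ge.
Qed.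

Lemma inner_content_bigsetU (U : (set X)^nat) n : (forall i, open (U i)) ->
  inner_content m (\big[setU/set0]_(i < n) U i) <=
  \sum_(i < n) inner_content m (U i).
Proof.
move=> oU; elim: n => [|n IH]; first by rewrite !big_ord0 inner_content0.
rewrite !big_ord_recr /=; apply: le_trans (leeD2r _ IH).
by apply: inner_content_setU => //; rewrite -bigcup_mkord; exact: bigcup_open.
Qed.

(** Compactness enters here: a closed set inside the union is covered by finitely many of the open
    sets. *)
Lemma inner_content_bigcup (U : (set X)^nat) : (forall i, open (U i)) ->
  inner_content m (\bigcup_i U i) <= \sum_(i <oo) inner_content m (U i).
Proof.
move=> oU; apply: ge_ereal_sup => _ [C [cC CU] <-].
have : compact C by apply: subclosed_compact cptX _.
rewrite compact_cover => /(_ nat setT U (fun i _ => oU i) CU) [D _ CD].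
pose n := (\max_(i <- finmap.enum_fset D) i).+1.
have Cn : C `<=` \big[setU/set0]_(i < n) U i.
  move=> x /CD [i /= iD Uix]; rewrite -bigcup_mkord; exists i => //=.
  by rewrite /n ltnS; apply: leq_bigmax_seq.
apply: le_trans (inner_content_ge cC Cn) _.
apply: le_trans (inner_content_bigsetU _ oU) _.
rewrite -(big_mkord xpredT (fun i => inner_content m (U i))).
by apply: nneseries_lim_ge => i _ _; exact: inner_content_ge0.
Qed.

Lemma outer_content_le U A : open U -> A `<=` U ->
  outer_content m A <= inner_content m U.
Proof. by move=> oU AU; apply: ereal_inf_lbound; exists U. Qed.

Lemma outer_content_ge0 A : 0 <= outer_content m A.
Proof.
by apply: le_ereal_inf_tmp => _ [U _ <-]; exact: inner_content_ge0.
Qed.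

Lemma outer_content0 : outer_content m set0 = 0.
Proof.
apply/eqP; rewrite eq_le outer_content_ge0 andbT -inner_content0.
by apply: outer_content_le => //; exact: open0.
Qed.

Lemma outer_content_le1 A : outer_content m A <= 1.
Proof. exact: le_trans (outer_content_le openT (@subsetT _ A)) (inner_content_le1 _). Qed.

Lemma outer_content_fin_num A : outer_content m A \is a fin_num.
Proof.
rewrite ge0_fin_numE ?outer_content_ge0//.
by rewrite (le_lt_trans (outer_content_le1 A))// ltry.
Qed.

Lemma le_outer_content : {homo outer_content m : A B / A `<=` B >-> A <= B}.
Proof.
move=> A B AB; apply: le_ereal_inf_tmp => _ [U [oU BU] <-].
by apply: outer_content_le => //; exact: subset_trans BU.
Qed.

Lemma outer_content_open U : open U -> outer_content m U = inner_content m U.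
Proof.
move=> oU; apply/eqP; rewrite eq_le outer_content_le//=.
by apply: le_ereal_inf_tmp => _ [V [_ UV] <-]; exact: le_inner_content.
Qed.

Lemma outer_content_closed C : closed C -> (m C)%:E <= outer_content m C.
Proof.
move=> cC; apply: le_ereal_inf_tmp => _ [V [_ UV] <-].
exact: inner_content_ge.
Qed.

Lemma outer_content_adherent A (e : R) : (0 < e)%R ->
  exists U, [/\ open U, A `<=` U & inner_content m U <= outer_content m A + e%:E].
Proof.
move=> e0.
have [_ [U [oU AU] <-] Ulte] := lb_ereal_inf_adherent e0 (outer_content_fin_num A).
by exists U; split => //; exact: ltW.
Qed.

Lemma outer_content_sigma_subadditive : sigma_subadditive (outer_content m).
Proof.
move=> A; apply/lee_addgt0Pr => e e0.
rewrite (le_trans _ (epsilon_trick _ _ (ltW e0)))//; last first.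
  by move=> n; exact: outer_content_ge0.
have en n : (0 < e / (2 ^ n.+1)%:R)%R by rewrite divr_gt0// ltr0n expn_gt0.
have [U UP] := choice (fun n => outer_content_adherent (A n) (en n)).
have oU i : open (U i) by case: (UP i).
apply: (@le_trans _ _ (inner_content m (\bigcup_i U i))).
  apply: outer_content_le; first by apply: bigcup_open => i _.
  by move=> x [i _ Aix]; exists i => //; case: (UP i) => _ + _; exact.
apply: (le_trans (inner_content_bigcup oU)).
apply: lee_nneseries => [i _ _|i _]; first exact: inner_content_ge0.
by case: (UP i).
Qed.

HB.instance Definition _ := isOuterMeasure.Build R X (outer_content m)
  outer_content0 outer_content_ge0 le_outer_content
  outer_content_sigma_subadditive.

(** Inside an open [V], a closed [C] nearly exhausts [V & U], then a closed [D] nearly exhausts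
    [V \ C], which contains [V \ U]. Being disjoint, [C] and [D] have contents that add up to at
    most that of [V]. *)
Lemma outer_content_caratheodory_open U : open U ->
  (outer_content m).-caratheodory U.
Proof.
move=> oU; apply: le_caratheodory_measurable => A /=.
apply: le_ereal_inf_tmp => _ [V [oV AV] <-].
apply: (@le_trans _ _ (inner_content m (V `&` U) + outer_content m (V `\` U))).
  apply: leeD; first by apply: outer_content_le; [exact: openI|exact: setSI].
  by apply: le_outer_content; exact: setSI.
have fin W : inner_content m W \is a fin_num.
  rewrite ge0_fin_numE ?inner_content_ge0//.
  by rewrite (le_lt_trans (inner_content_le1 W))// ltry.
apply/lee_addgt0Pr => e e0.
have e20 : (0 < e / 2)%R by rewrite divr_gt0.
have [_ [C [cC CVU] <-] mC] := ub_ereal_sup_adherent e20 (fin (V `&` U)).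
have oVC : open (V `\` C) by rewrite setDE; apply: openI => //; apply: closed_openC.
have [_ [D [cD DVC] <-] mCD] := ub_ereal_sup_adherent e20 (fin (V `\` C)).
rewrite -/(inner_content _ _) in mC mCD.
rewrite lteBlDr// in mC; rewrite lteBlDr// in mCD.
have VUC : outer_content m (V `\` U) <= inner_content m (V `\` C).
  apply: outer_content_le => // x [Vx nUx]; split => // Cx.
  by apply: nUx; case: (CVU x Cx).
apply: (@le_trans _ _ (((m C)%:E + (e/2)%:E) + ((m D)%:E + (e/2)%:E))).
  by apply: leeD; [exact: ltW|exact: le_trans VUC (ltW _)].
rewrite -!EFinD addrACA -splitr EFinD leeD2r//.
apply: le_trans (_ : (m (C `|` D))%:E <= _).
  rewrite lee_fin mD// -subset0 => x [Cx /DVC[]]. by [].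
apply: inner_content_ge; first exact: closedU.
by rewrite subUset; split=> [x /CVU[]//|x /DVC[]//].
Qed.

Lemma borel_caratheodory (A : set (borelType X)) : measurable A ->
  (outer_content m).-caratheodory A.
Proof.
move=> mA; apply: (@smallest_sub _ _ (@open X) (outer_content m).-caratheodory) mA.
- have := @sigma_algebra_measurable _ (caratheodory_type (outer_content m)).
  exact.
- by move=> U; exact: outer_content_caratheodory_open.
Qed.

Let nu : set (borelType X) -> \bar R := outer_content m.

Let nu0 : nu set0 = 0. Proof. exact: outer_content0. Qed.

Let nu_ge0 A : 0 <= nu A. Proof. exact: outer_content_ge0. Qed.

Let nu_sigma_additive : semi_sigma_additive nu.
Proof.
move=> A mA tA mbA.
have := @caratheodory_measure_sigma_additive R X (outer_content m).
by apply => // [i|]; exact: borel_caratheodory.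
Qed.

HB.instance Definition _ := isMeasure.Build _ _ _ nu nu0 nu_ge0 nu_sigma_additive.

Let nuT : nu setT = 1.
Proof.
rewrite /nu outer_content_open; last exact: openT.
apply/eqP; rewrite eq_le inner_content_le1 /=.
apply: le_trans (inner_content_ge closedT (@subsetT _ _)).
by case: mP => _ _ _ ->.
Qed.

HB.instance Definition _ := Measure_isProbability.Build _ _ _ nu nuT.

Definition content_probability : probability (borelType X) R := nu.

End closed_contents.

(** Passing through open neighbourhoods can only increase the value on a closed set, hence the
    inequality. Invariance survives because a homeomorphism permutes the open and the closed sets
    over which the two extrema are taken. *)
Lemma closed_content_extension (R : realType) (X : pmetricType R)
    (m : set X -> R) : compact [set: X] -> closed_content m ->
  exists mu : probability (borelType X) R,
    (forall C : set X, closed C -> (m C)%:E <= mu C)%E /\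
    forall T : X -> X, homeomorphism T ->
      (forall C : set X, closed C -> m (T @^-1` C) = m C) ->
      invariant_measure T mu.
Proof.
move=> cptX mP; exists (content_probability cptX mP); split.
  by move=> C cC; exact: outer_content_closed.
(* Applied to [T] and then to its inverse, this yields both inequalities. *)
have half (T T' : X -> X) A : continuous T -> continuous T' ->
    cancel T T' -> cancel T' T ->
    (forall C : set X, closed C -> m (T @^-1` C) = m C) ->
    (outer_content m (T @^-1` A) <= outer_content m A)%E.
  move=> cT cT' TK T'K mT; apply: le_ereal_inf_tmp => _ [U [oU AU] <-].
  apply: (@le_trans _ _ (inner_content m (T @^-1` U))).
    apply: outer_content_le; first by apply: open_comp => // x _; exact: cT.
    by move=> x; exact: AU.
  apply: ge_ereal_sup => _ [C [cC CU] <-].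
  have -> : C = T @^-1` (T' @^-1` C) by apply/seteqP; split => x /=; rewrite TK.
  have cC' : closed (T' @^-1` C) by apply: closed_comp => // x _; exact: cT'.
  rewrite mT//; apply: inner_content_ge => // x /= /CU /=.
  by rewrite T'K.
move=> T [cT [T' [TK T'K cT']]] mT A mA.
apply/eqP; rewrite eq_le; apply/andP; split; first exact: (half T T').
have {1}-> : A = T' @^-1` (T @^-1` A) by apply/seteqP; split => x /=; rewrite T'K.
apply: (half T' T) => // C cC; rewrite -[LHS]mT; last first.
  by apply: closed_comp => // x _; exact: cT'.
by congr m; apply/seteqP; split => x /=; rewrite TK.
Qed.

(** * Limits of measures and ergodic measures *)

Lemma borel_closed (R : realType) (X : pmetricType R) (C : set X) :
  closed C -> measurable (C : set (borelType X)).
Proof.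
move=> cC; rewrite -[C]setCK; apply: measurableC.
by apply: sub_sigma_algebra; exact: closed_openC.
Qed.

Lemma cvg_ultra (R : realType) (U : set_system nat) (UU : UltraFilter U)
    (u : nat -> R) (a b : R) : (forall j, a <= u j <= b) ->
  exists l : R, u j @[j --> U] --> l.
Proof.
move=> uab.
have : compact `[a, b] by exact: segment_compact.
rewrite compact_ultra => /(_ (u @ U)) [].
- split=> [|G PG sG]; first exact: fmap_proper_filter.
  apply/seteqP; split => [B GB|]; last exact: sG.
  have [//|nB] := in_ultra_setVsetC (u @^-1` B) UU.
  have : G (B `&` ~` B) by apply: filterI => //; exact: sG.
  by rewrite setICr => /filter_not_empty.
- by apply: (@filterE _ U) => j /=; rewrite in_itv /= uab.
- by move=> l [_ ul]; exists l.
Qed.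

Lemma free_ultrafilter : exists U : set_system nat, UltraFilter U /\ \oo `<=` U.
Proof. exact: ultraFilterLemma. Qed.

Section ultralimits.
Context {R : realType} {X : pmetricType R} (cptX : compact [set: X]).
Context (U : set_system nat) (UU : UltraFilter U) (Uoo : \oo `<=` U).

(** Limits along a free ultrafilter, taken set by set, stand in for weak-star compactness. They
    preserve the axioms of a content on closed sets; the extension then supplies countable
    additivity but may enlarge closed sets. What remains is upper semicontinuity on closed sets, as
    in the portmanteau theorem. *)
Lemma content_ultralimit (m : nat -> set X -> R) :
  (forall j, closed_content (m j)) ->
  exists mu : probability (borelType X) R,
    (forall C c, closed C -> U [set j | c <= m j C] -> (c%:E <= mu C)%E) /\
    forall T : X -> X, homeomorphism T ->
      (forall C : set X, closed C ->
        (m j (T @^-1` C) - m j C) @[j --> \oo] --> (0 : R)) ->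
      invariant_measure T mu.
Proof.
move=> mP.
have m01 C j : closed C -> 0 <= m j C <= 1.
  move=> cC; rewrite (closed_content_ge0 (mP j)) //=.
  by have [mS _ _ <-] := mP j; apply: mS => //; exact: closedT.
have mlim (C : set X) : exists l : R, closed C -> m j C @[j --> U] --> l.
  have [cC|nC] := pselect (closed C); last by exists 0.
  by have [l ml] := cvg_ultra UU (fun j => m01 C j cC); exists l.
have [m_ m_cvg] := choice mlim.
have FU : ProperFilter U := @ultra_proper _ _ UU.
have m_P : closed_content m_.
  split.
  - move=> C D cC cD CD; apply: ler_cvg_to (m_cvg C cC) (m_cvg D cD) _.
    by apply: nearW => j; have [+ _ _ _] := mP j; exact.
  - move=> C D cC cD.
    apply: ler_cvg_to (m_cvg _ (closedU cC cD)) (cvgD (m_cvg C cC) (m_cvg D cD)) _.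
    by apply: nearW => j; have [_ + _ _] := mP j; exact.
  - move=> C D cC cD CD.
    apply: ler_cvg_to (cvgD (m_cvg C cC) (m_cvg D cD)) (m_cvg _ (closedU cC cD)) _.
    by apply: nearW => j; have [_ _ + _] := mP j; exact.
  - apply/esym/(cvg_unique _ _ (m_cvg _ closedT)); first exact: norm_hausdorff.
    rewrite (_ : (fun _ => _) = fun=> 1); first exact: cvg_cst.
    by apply/funext => j; have [_ _ _ ->] := mP j.
have [mu [muC muT]] := closed_content_extension cptX m_P.
exists mu; split=> [C c cC cm|T hT mT].
  apply: le_trans (muC C cC); rewrite lee_fin.
  exact: (ler_cvg_to (cvg_cst c) (m_cvg C cC) cm).
apply: muT => // C cC; have [cT _] := hT.
have cTC : closed (T @^-1` C) by apply: closed_comp => // x _; exact: cT.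
apply/eqP; rewrite -subr_eq0; apply/eqP.
apply: (cvg_unique _ (cvgB (m_cvg _ cTC) (m_cvg C cC))); first exact: norm_hausdorff.
exact: cvg_trans (cvg_app _ Uoo) (mT C cC).
Qed.

Lemma closed_content_probability (mu : probability (borelType X) R) :
  closed_content (fun C => fine (mu C)).
Proof.
have mC := @borel_closed R X.
have fin (C : set (borelType X)) : measurable C -> mu C \is a fin_num.
  exact: fin_num_measure.
split=> [C D cC cD CD|C D cC cD|C D cC cD CD|].
- apply: fine_le; rewrite ?fin//; try exact: mC.
  by apply: le_measure; rewrite ?inE//; exact: mC.
- rewrite -fineD ?fin//; try exact: mC.
  apply: fine_le; rewrite ?fin_numD ?fin//; try exact: mC.
    by apply: measurableU; exact: mC.
  by apply: measureU2; exact: mC.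
- rewrite -fineD ?fin//; try exact: mC.
  by rewrite le_eqVlt; apply/orP; left; rewrite measureU//; exact: mC.
- by rewrite /= probability_setT.
Qed.

Lemma probability_ultralimit (T : X -> X)
    (mu_ : nat -> probability (borelType X) R) : homeomorphism T ->
  (forall j, invariant_measure T (mu_ j)) ->
  exists2 mu : probability (borelType X) R, invariant_measure T mu &
    forall (C : set X) (c : R), closed C -> U [set j | (c%:E <= mu_ j C)%E] ->
      (c%:E <= mu C)%E.
Proof.
move=> hT muT.
have mC := @borel_closed R X.
have [mu [muU muinv]] :=
  content_ultralimit (fun j => closed_content_probability (mu_ j)).
exists mu.
  apply: muinv => // C cC.
  rewrite (_ : (fun _ => _) = fun=> 0); first exact: cvg_cst.
  by apply/funext => j; rewrite muT ?subrr//; exact: mC.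
move=> C c cC cmu; apply: muU => //; apply: filterS cmu => j /= cmu.
by rewrite -lee_fin fineK// fin_num_measure//; exact: mC.
Qed.

End ultralimits.

(** * Determination of Borel measures by countably many closed sets *)

Section ergodic_measures.
Context {R : realType} {X : pmetricType R} (cptX : compact [set: X]).

Lemma borel_preimage (T : X -> X) (A : set (borelType X)) :
  continuous T -> measurable A -> measurable (T @^-1` A : set (borelType X)).
Proof.
move=> cT mA.
pose G := [set B : set X | measurable (T @^-1` B : set (borelType X))].
apply: (@smallest_sub _ _ (@open X) G) mA.
  split=> [|B GB|B GB].
  - by rewrite /G /= preimage_set0; exact: measurable0.
  - rewrite /G /= setTD preimage_setC; exact: measurableC.
  - by rewrite /G /= preimage_bigcup; exact: bigcupT_measurable.
move=> V oV; apply: sub_sigma_algebra.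
by apply: open_comp => // x _; exact: cT.
Qed.

(** The sets are complements of finite unions from a countable base, finite index sets being coded
    by natural numbers. Closed generators are wanted because limits of measures are controlled on
    closed sets only. *)
Lemma countable_closed_pi_system : exists C : nat -> set X,
  [/\ forall k, closed (C k), setI_closed (range C), range C setT &
      forall A : set (borelType X), measurable A -> <<s range C >> A].
Proof.
have [B Bcnt [Bo Bb]] := compact_second_countable cptX.
have /pcard_injP[f finj] : (B #<= [set: nat])%card by exact: Bcnt.
(* [b] lists the base along the injection [f]; an index outside the image of [f] gives the empty
   set. *)
pose b i := \bigcup_(V in [set V | B V /\ f V = i]) V.
have bo i : open (b i) by apply: bigcup_open => V [BV _]; exact: Bo.
have bf V : B V -> b (f V) = V.
  move=> BV; apply/seteqP; split=> [x [W [BW fW] Wx]|x Vx].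
    by rewrite -(finj W V) ?inE//.
  by exists V.
pose code k : seq nat := odflt [::] (choice.unpickle k).
pose C k := ~` \bigcup_(i in [set` code k]) b i.
have CE (s : seq nat) : C (choice.pickle s) = ~` \bigcup_(i in [set` s]) b i.
  by rewrite /C /code choice.pickleK.
exists C; split.
- by move=> k; apply: open_closedC; apply: bigcup_open.
- move=> _ _ [i _ <-] [j _ <-].
  exists (choice.pickle (code i ++ code j)) => //.
  rewrite CE /C -setCU -bigcup_setU; congr (~` bigcup _ _).
  by apply/seteqP; split=> k /=; rewrite mem_cat => /orP.
- exists (choice.pickle ([::] : seq nat)) => //; rewrite CE.
  by rewrite bigcup0 ?setC0//.
- move=> A mA; apply: smallest_sub mA; first exact: smallest_sigma_algebra.
  move=> V oV.
  have -> : V = \bigcup_i (if `[< b i `<=` V >] then b i else set0).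
    apply/seteqP; split=> [x Vx|x [i _]].
      have [W [BW Wx] WV] : filter_from [set U | B U /\ U x] id V.
        by apply: Bb; exact: open_nbhs_nbhs.
      exists (f W) => //; rewrite bf//.
      by case: asboolP.
    by case: asboolP => // bV /bV.
  pose GT : measurableType _ := g_sigma_algebraType (range C).
  apply: (@bigcupT_measurable _ GT) => i; case: asboolP => _; last exact: measurable0.
  rewrite -[b i]setCK; apply: (@measurableC _ GT).
  apply: sub_sigma_algebra; exists (choice.pickle [:: i]) => //.
  rewrite CE; congr (~` _).
  by apply/seteqP; split=> [x [k /=]|x bx]; [rewrite inE => /eqP ->|exists i => //=; rewrite inE].
Qed.

Lemma probability_unique_pi_system (C : nat -> set X)
    (mu nu : probability (borelType X) R) :
  (forall k, closed (C k)) -> setI_closed (range C) -> range C setT ->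
  (forall A : set (borelType X), measurable A -> <<s range C >> A) ->
  (forall k, mu (C k) = nu (C k)) ->
  forall A : set (borelType X), measurable A -> mu A = nu A.
Proof.
move=> cC CI CT Cm munu A /Cm.
have GM : range C `<=` (measurable : set (set (borelType X))).
  by move=> _ [k _ <-]; exact: borel_closed.
apply: (@g_sigma_algebra_measure_unique _ R (borelType X) _ GM (fun=> setT)
  (fun=> CT) _ mu nu CI).
- by rewrite bigcup_const//; exists 0%N.
- by move=> _ [k _ <-]; exact: munu.
- by move=> k; rewrite /= probability_setT ltry.
Qed.

End ergodic_measures.

(** * Empirical measures and extremal invariant measures *)

Section empirical_measures.
Context {R : realType} {X : pmetricType R} (cptX : compact [set: X]).
Context (T : X -> X) (hT : homeomorphism T).

Definition empirical (x : X) (n : nat) (C : set X) : R :=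
  n%:R^-1 * \sum_(t < n) (iter t T x \in C)%:R.

Lemma empirical_content x n : (0 < n)%N -> closed_content (empirical x n).
Proof.
move=> n0; have ni : 0 <= n%:R^-1 :> R by rewrite invr_ge0.
split=> [C D _ _ CD|C D _ _|C D _ _ CD|].
- apply: ler_wpM2l => //; apply: ler_sum => t _; rewrite ler_nat.
  have [/set_mem/CD/mem_set ->//|//] := boolP (_ \in C).
- rewrite /empirical -mulrDr -big_split /=; apply: ler_wpM2l => //.
  apply: ler_sum => t _; rewrite -natrD ler_nat in_setU.
  by case: (_ \in C); case: (_ \in D).
- rewrite /empirical -mulrDr -big_split /=; apply: ler_wpM2l => //.
  apply: ler_sum => t _; rewrite -natrD ler_nat in_setU.
  have [/set_mem tC|//] := boolP (_ \in C); have [/set_mem tD|//] := boolP (_ \in D).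
  by have : (C `&` D) (iter t T x) by []; rewrite CD.
- rewrite /empirical (eq_bigr (fun=> 1)); last by move=> t _; rewrite in_setT.
  by rewrite sumr_const card_ord mulVf// pnatr_eq0 -lt0n.
Qed.

Lemma empirical_invariant x n C :
  `|empirical x n (T @^-1` C) - empirical x n C| <= n%:R^-1.
Proof.
rewrite /empirical -mulrBr normrM ger0_norm ?invr_ge0//.
rewrite ler_piMr ?invr_ge0// -sumrB.
(* The sum telescopes, leaving only the two ends of the orbit. *)
have -> : \sum_(t < n) ((iter t T x \in T @^-1` C)%:R - (iter t T x \in C)%:R) =
    (iter n T x \in C)%:R - (x \in C)%:R :> R.
  rewrite -(big_mkord xpredT (fun t => (iter t T x \in T @^-1` C)%:R - (iter t T x \in C)%:R)).
  exact: (telescope_sumr (fun t => (iter t T x \in C)%:R) (leq0n n)).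
case: (_ \in C); case: (_ \in C); rewrite /= ?subrr ?subr0 ?sub0r ?normrN ?normr1 ?normr0//.
Qed.

(** The Krylov-Bogolyubov argument. [j < N j] makes the defect of invariance vanish in the limit; as
    [K] decreases, every late empirical measure gives each fixed [K i] mass at least [c], and
    continuity from above reaches the intersection. *)
Lemma invariant_measure_of_frequency (K : nat -> set X) (x : nat -> X)
    (N : nat -> nat) (c : R) :
  (forall j, closed (K j)) -> nonincreasing_seq K -> (forall j, (j < N j)%N) ->
  (forall j, c <= empirical (x j) (N j) (K j)) ->
  exists2 mu : probability (borelType X) R, invariant_measure T mu &
    (c%:E <= mu (\bigcap_j K j))%E.
Proof.
move=> cK decK jN cK_.
have [U [UU Uoo]] := free_ultrafilter.
have N0 j : (0 < N j)%N by exact: leq_ltn_trans (jN j).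
have [mu [muU muT]] :=
  content_ultralimit cptX UU Uoo (fun j => empirical_content (x j) (N0 j)).
exists mu.
  apply: muT => // C cC; apply/cvgr0Pnorm_le => e e0; near=> j.
  apply: (le_trans (empirical_invariant _ _ _)).
  apply: (@le_trans _ _ (j.+1%:R^-1)).
    by rewrite lef_pV2 ?posrE ?ltr0n// ler_nat.
  apply: ltW; near: j; exact: (near_infty_natSinv_lt (PosNum e0)).
have muK i : (c%:E <= mu (K i))%E.
  apply: muU => //; apply: Uoo; exists i => // j /= ij.
  apply: (le_trans (cK_ j)); have [mS _ _ _] := empirical_content (x j) (N0 j).
  by apply: mS => //; exact/subsetPset/decK.
have : mu (K i) @[i --> \oo] --> mu (\bigcap_j K j).
  apply: nonincreasing_cvg_mu => //.
  - by rewrite (le_lt_trans (probability_le1 _ _)) ?ltry//; exact: borel_closed.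
  - by move=> i; exact: borel_closed.
  - by apply: borel_closed; exact: closed_bigI.
move=> muKcvg.
apply: (@cvge_to_ge _ _ _ _ (fun i => mu (K i)) _ _ muKcvg).
exact: nearW.
Unshelve. all: by end_near. Qed.

Let prob := probability (borelType X) R.

Definition conditional (mu : prob) (A : set (borelType X)) (mA : measurable A) :
  prob := mnormalize (mrestr mu mA) mu.

Lemma conditionalE (mu : prob) (A : set (borelType X)) (mA : measurable A) B :
  mu A != 0 -> conditional mu mA B = (mu (B `&` A) * (fine (mu A))^-1%:E)%E.
Proof.
move=> muA; rewrite /conditional /= /mnormalize /= /mrestr setTI (negbTE muA) /=.
by rewrite lt_eqF// (le_lt_trans (probability_le1 _ mA)) ?ltry.
Qed.

Lemma invariant_conditional (mu : prob) (A : set (borelType X))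
    (mA : measurable A) :
  invariant_measure T mu -> T @^-1` A = A -> mu A != 0 ->
  invariant_measure T (conditional mu mA).
Proof.
move=> muT TA muA B mB; rewrite !conditionalE//; congr (_ * _)%E.
rewrite -{1}TA -preimage_setI muT//; exact: measurableI.
Qed.

Section lexicographic_maximum.
Variable C : nat -> set X.
Hypothesis cC : forall k, closed (C k).

(* [mu (C k)] is upper semicontinuous in [mu], so each maximum is attained; a
   measure which is maximal at every stage is an extreme point when the [C k]
   determine measures, hence ergodic. *)
Fixpoint lex_max (k : nat) : set prob :=
  if k is k'.+1 then
    [set mu | lex_max k' mu /\ forall nu, lex_max k' nu -> (nu (C k') <= mu (C k'))%E]
  else [set mu | invariant_measure T mu].

Lemma lex_max_le k l : (k <= l)%N -> lex_max l `<=` lex_max k.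
Proof.
move=> /subnK <-; elim: (l - k)%N => [//|i IH] mu [/= mui _]; exact: IH.
Qed.

Lemma lex_max_ultralimit (U : set_system nat) (mu_ : nat -> prob) (mu : prob) k :
  UltraFilter U -> invariant_measure T mu ->
  (forall (D : set X) (c : R), closed D -> U [set j | (c%:E <= mu_ j D)%E] ->
    (c%:E <= mu D)%E) ->
  U [set j | lex_max k (mu_ j)] -> lex_max k mu.
Proof.
move=> UU muT muU; elim: k => [//|k IH] Uk; split.
  by apply: IH; apply: filterS Uk => j [].
move=> nu nuk; rewrite -[leLHS]fineK ?fin_num_measure//; last exact: borel_closed.
apply: muU => //; apply: filterS Uk => j [_ /(_ _ nuk)] /=.
by rewrite fineK// fin_num_measure//; exact: borel_closed.
Qed.

(** A maximizing sequence for [C k] has an ultralimit that stays in stage [k] and, [C k] being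
    closed, attains the supremum. *)
Lemma lex_max_nonempty k : lex_max 0 !=set0 -> lex_max k !=set0.
Proof.
move=> ne; elim: k => [//|k [mu0 mu0k]].
have [U [UU Uoo]] := free_ultrafilter.
pose s := ereal_sup [set nu (C k) | nu in lex_max k].
have mC : measurable (C k : set (borelType X)) by exact: borel_closed.
have sfin : s \is a fin_num.
  rewrite ge0_fin_numE.
    apply: (@le_lt_trans _ _ 1%E); last exact: ltry.
    by apply: ge_ereal_sup => _ [nu _ <-]; exact: probability_le1.
  apply: (@le_trans _ _ (mu0 (C k))); first exact: measure_ge0.
  by apply: ereal_sup_ubound; exists mu0.
have /choice[mu_ mu_P] j : exists nu,
    lex_max k nu /\ (s - (j.+1%:R^-1)%:E < nu (C k))%E.
  have e0 : 0 < j.+1%:R^-1 :> R by [].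
  have [_ [nu nuk <-] snu] := ub_ereal_sup_adherent e0 sfin.
  by exists nu.
have [|mu muT muU] := probability_ultralimit cptX UU Uoo hT (mu_ := mu_).
  by move=> j; apply: (lex_max_le (leq0n k)); case: (mu_P j).
have muk : lex_max k mu.
  by apply: (lex_max_ultralimit UU muT muU); apply: filterE => j; case: (mu_P j).
exists mu; split => // nu nuk.
apply: (@le_trans _ _ s); first by apply: ereal_sup_ubound; exists nu.
rewrite -(fineK sfin); apply/lee_addgt0Pr => e e0.
rewrite -leeBlDr// -EFinB.
apply: muU => //; apply: Uoo.
have [N _ NP] := near_infty_natSinv_lt (PosNum e0).
exists N => // j /= /NP /= je; have [_ /ltW] := mu_P j; apply: le_trans.
by rewrite -(fineK sfin) -EFinB lee_fin lerB// ltW.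
Qed.

(** A diagonal argument: the [j]-th measure has passed the first [j] stages, so the ultralimit
    passes all of them. *)
Lemma lex_max_bigcap : lex_max 0 !=set0 -> exists mu, forall k, lex_max k mu.
Proof.
move=> ne; have [U [UU Uoo]] := free_ultrafilter.
have /choice[mu_ mu_P] j := lex_max_nonempty j ne.
have [|mu muT muU] := probability_ultralimit cptX UU Uoo hT (mu_ := mu_).
  by move=> j; exact: (lex_max_le (leq0n j)).
exists mu => k; apply: (lex_max_ultralimit UU muT muU); apply: Uoo.
by exists k => // j /= kj; exact: (lex_max_le kj).
Qed.

(** Induction on the stage: two components that have survived so far have values on [C k] at most
    the maximum, while their average equals it. Both then attain it and survive further. *)
Lemma lex_max_face (mu mu1 mu2 : prob) (a b : R) :
  0 < a -> 0 < b -> a + b = 1 ->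
  invariant_measure T mu1 -> invariant_measure T mu2 ->
  (forall k, mu (C k) = a%:E * mu1 (C k) + b%:E * mu2 (C k))%E ->
  (forall k, lex_max k mu) -> forall k, mu1 (C k) = mu2 (C k).
Proof.
move=> a0 b0 ab mu1T mu2T muE muk.
have fC (nu : prob) k : nu (C k) = (fine (nu (C k)))%:E.
  by rewrite fineK// fin_num_measure//; exact: borel_closed.
have key k : lex_max k mu1 -> lex_max k mu2 ->
    mu1 (C k) = mu (C k) /\ mu2 (C k) = mu (C k).
  move=> mu1k mu2k; have [_ max] := muk k.+1.
  have := muE k; have := max _ mu1k; have := max _ mu2k.
  rewrite (fC mu) (fC mu1) (fC mu2) -!EFinM -EFinD !lee_fin.
  move: (fine (mu _)) (fine (mu1 _)) (fine (mu2 _)) => x y z zx yx [xE].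
  have : a * (x - y) + b * (x - z) = 0.
    by rewrite !mulrBr addrACA -opprD -xE -mulrDl ab mul1r subrr.
  move/eqP; rewrite paddr_eq0 ?mulr_ge0 ?subr_ge0 ?(ltW a0) ?(ltW b0)//.
  rewrite !mulf_eq0 (gt_eqF a0) (gt_eqF b0) /= !subr_eq0.
  by move=> /andP[/eqP <- /eqP <-].
suff main k : lex_max k mu1 /\ lex_max k mu2.
  by move=> k; have [m1 m2] := main k; have [-> ->] := key k m1 m2.
elim: k => [//|k [m1 m2]]; have [e1 e2] := key k m1 m2.
have [_ max] := muk k.+1.
by split; split => // nu nuk; [rewrite e1|rewrite e2]; exact: max.
Qed.

End lexicographic_maximum.

(** Maximizing on [K] first keeps the mass at least [c]. If an invariant [A] split the lexicographic
    maximum, its two conditional measures would agree on a determining family, although one is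
    carried by [A] and the other by its complement. *)
Lemma ergodic_measure_closed (K : set X) (mu : prob) (c : R) :
  closed K -> invariant_measure T mu -> (c%:E <= mu K)%E ->
  exists2 nu : prob, ergodic_measure T nu & (c%:E <= nu K)%E.
Proof.
move=> cK muT cmu.
have [C0 [cC0 C0I C0T C0m]] := countable_closed_pi_system cptX.
pose C k := if k is k'.+1 then C0 k' else K.
have cC k : closed (C k) by case: k.
have [|nu nuk] := @lex_max_bigcap C cC; first by exists mu.
have nuT : invariant_measure T nu := nuk 0%N.
exists nu; last by have [_ /(_ _ muT)] := nuk 1%N; exact: le_trans.
split => // A mA TA.
have [|A0] := eqVneq (nu A) 0%E; first by left.
right; apply/eqP/negP => /negP A1.
have mCA := measurableC mA.
have nuAf : nu A \is a fin_num by rewrite fin_num_measure.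
have nuCA : nu (~` A) = (1 - nu A)%E by exact: probability_setC.
have CA0 : nu (~` A) != 0%E.
  rewrite nuCA; apply: contra A1 => /eqP.
  rewrite -(fineK nuAf) -EFinB => -[/eqP].
  by rewrite subr_eq0 eq_sym => /eqP ->.
have TCA : T @^-1` (~` A) = ~` A by rewrite -[in RHS]TA.
have nuCAf : nu (~` A) \is a fin_num by rewrite fin_num_measure.
pose nu1 := conditional nu mA; pose nu2 := conditional nu mCA.
have fpos (B : set (borelType X)) : measurable B -> nu B != 0%E -> 0 < fine (nu B).
  move=> mB B0; rewrite fine_gt0// lt0e B0 measure_ge0 /=.
  by rewrite (le_lt_trans (probability_le1 _ mB)) ?ltry.
have nu12 k : nu1 (C k) = nu2 (C k).
  apply: (@lex_max_face C cC nu _ _ (fine (nu A)) (fine (nu (~` A)))) => //.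
  - exact: fpos.
  - exact: fpos.
  - by rewrite nuCA fineB// addrC subrK.
  - exact: invariant_conditional.
  - exact: invariant_conditional.
  move=> j; rewrite /nu1 /nu2 !conditionalE//.
  have mCj : measurable (C j : set (borelType X)) by exact: borel_closed.
  rewrite muleCA -EFinM divff ?gt_eqF ?fpos// mule1.
  rewrite muleCA -EFinM divff ?gt_eqF ?fpos// mule1.
  rewrite -measureU//; [|exact: measurableI..|]; last first.
    by rewrite setIACA setICr setI0.
  by rewrite -setIUr setUv setIT.
have := probability_unique_pi_system cC0 C0I C0T C0m (fun k => nu12 k.+1) mA.
rewrite /nu1 /nu2 !conditionalE// setIid setICr measure0 mul0e.
move/eqP; rewrite mule_eq0 (negbTE A0) /= eqe invr_eq0 gt_eqF//; exact: fpos.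
Qed.

End empirical_measures.

(** * Words and tilings *)

Section words.
Context {R : realType} {X : pmetricType R} (T : X -> X).
Context {A : finType} (net : A -> X) (r : R).

Definition occurrences (P : pred X) (N : nat) (x : X) : nat :=
  (\sum_(t < N) P (iter t T x))%N.

Lemma occurrencesS P N x :
  occurrences P N.+1 x = (P x + occurrences P N (T x))%N.
Proof.
rewrite /occurrences big_ord_recl; congr (_ + _)%N.
by apply: eq_bigr => t _; rewrite iterSr.
Qed.

Lemma occurrencesD P M N x :
  occurrences P (M + N) x =
  (occurrences P M x + occurrences P N (iter M T x))%N.
Proof.
elim: M x => [|M IH] x; first by rewrite /occurrences big_ord0.
by rewrite addSn !occurrencesS IH addnA iterSr.
Qed.

Fixpoint matches (x : X) (w : seq A) : bool :=
  if w is a :: w' then (mdist x (net a) < r) && matches (T x) w' else true.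

Lemma matches_cat x v w :
  matches x (v ++ w) = matches x v && matches (iter (size v) T x) w.
Proof.
by elim: v x => [//|a v IH] x; rewrite cat_cons [LHS]/= IH andbA -iterSr.
Qed.

Lemma matches_drop s x w :
  matches x w -> matches (iter s T x) (drop s w).
Proof.
elim: s x w => [|s IH] x [|a w]; rewrite ?drop0//.
by move=> /andP[_ /IH]; rewrite iterSr.
Qed.

Lemma open_matches w : continuous T -> open [set x | matches x w].
Proof.
move=> cT; elim: w => [|a w IH] /=.
  by rewrite (_ : [set _ | _] = setT); [exact: openT|apply/seteqP].
rewrite (_ : [set x | _] = [set x | mdist x (net a) < r] `&` T @^-1` [set x | matches x w]).
  apply: openI; last by apply: open_comp => // x _; exact: cT.
  rewrite openE => x /= xr; apply/nbhs_ballP.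
  exists (r - mdist x (net a)); first by rewrite /= subr_gt0.
  move=> y; rewrite ballEmdist /= => xy; apply: le_lt_trans (metric_triangle y x (net a)) _.
  by rewrite metric_sym -ltrBrDr.
by apply/seteqP; split => x /= /andP.
Qed.

Fixpoint words (N : nat) : seq (seq A) :=
  if N is n.+1 then [seq a :: w | a <- enum A, w <- words n] else [:: [::]].

Lemma size_words N : size (words N) = (#|A| ^ N)%N.
Proof. by elim: N => [//|N IH] /=; rewrite size_allpairs IH -cardE expnS. Qed.

Lemma mem_words N w : w \in words N -> size w = N.
Proof.
elim: N w => [|N IH] w /=; first by rewrite inE => /eqP ->.
by move=> /allpairsP[[a v] /= [_ /IH vN ->]] /=; rewrite vN.
Qed.

Section tilings.
Variable V : seq (seq A).

(* [k] bounds the number of single letters used between tiles. Once at most [k]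
   letters are left they are unconstrained, which absorbs a tile overshooting
   the end; [fuel] is meant to be at least [N]. *)
Fixpoint tilings (fuel N k : nat) : seq (seq A) :=
  if (N <= k)%N then words N else
  if fuel is f.+1 then
    (if k is k'.+1 then [seq a :: w | a <- enum A, w <- tilings f N.-1 k']
     else [::]) ++
    flatten [seq [seq v ++ w | w <- tilings f (N - size v) k]
            | v <- [seq v <- V | (size v <= N)%N]]
  else [::].

Definition kraft (Z : R) : R := \sum_(v <- V) Z ^- size v.

Lemma mem_tilings f N k w : w \in tilings f N k -> size w = N.
Proof.
elim: f N k w => [|f IH] N k w /=; case: leqP => kN //; try exact: mem_words.
rewrite mem_cat => /orP[|].
  case: k kN => [//|k] kN /allpairsP[[a v] /= [_ /IH vN ->]] /=.
  by rewrite vN prednK// (leq_trans _ kN).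
move=> /flatten_mapP[v]; rewrite mem_filter => /andP[vN _] /mapP[u /IH uN ->].
by rewrite size_cat uN subnKC.
Qed.

(** The first item is a free letter or a tile, and each case takes half of the bound: the free
    letter through the doubling of [#|A|], the tiles through the Kraft sum being at most 1/2. *)
Lemma size_tilings (Z : R) f N k : (0 < #|A|)%N -> 1 <= Z -> kraft Z <= 2^-1 ->
  (size (tilings f N k))%:R <= (#|A|.*2)%:R ^+ k * Z ^+ N.
Proof.
move=> A0 Z1 kZ; have Z0 : 0 < Z by exact: lt_le_trans Z1.
have A1 : 1 <= #|A|%:R :> R by rewrite ler1n.
have A2 : 1 <= (#|A|.*2)%:R :> R by rewrite ler1n double_gt0.
have c0 l n : 0 <= (#|A|.*2)%:R ^+ l * Z ^+ n :> R.
  by apply: mulr_ge0; apply: exprn_ge0; [exact: ler0n|exact: ltW].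
have wordsle n l : (n <= l)%N -> (size (words n))%:R <= (#|A|.*2)%:R ^+ l * Z ^+ n :> R.
  move=> nl; rewrite size_words natrX -[leLHS]mulr1.
  apply: ler_pM => //; last exact: exprn_ege1.
    apply: (@le_trans _ _ ((#|A|.*2)%:R ^+ n)); last exact: ler_weXn2l.
    by rewrite lerXn2r ?nnegrE// ler_nat -addnn leq_addr.
elim: f N k => [|f IH] N k /=; case: leqP => kN; rewrite ?wordsle//.
rewrite size_cat natrD -[_ ^+ k * _]mul1r [X in X * (_ * _)](_ : _ = 2^-1 + 2^-1); last first.
  by rewrite -mulr2n -[RHS]mulr_natl mulfV.
rewrite mulrDl; apply: lerD.
  case: k kN => [|k] kN; first by apply: mulr_ge0 => //; exact: c0.
  rewrite size_allpairs -cardE natrM.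
  apply: (le_trans (ler_wpM2l _ (IH N.-1 k))); first exact: ler0n.
  rewrite exprS -[in leRHS](prednK (leq_trans (ltn0Sn _) kN)) exprS.
  rewrite -muln2 natrM.
  have -> : 2^-1 * (#|A|%:R * 2%:R * (#|A|%:R * 2%:R) ^+ k * (Z * Z ^+ N.-1)) =
    (#|A|%:R * ((#|A|%:R * 2%:R) ^+ k * Z ^+ N.-1)) * Z :> R by field.
  rewrite ler_peMr//; apply: mulr_ge0 => //; rewrite -natrM muln2; exact: c0.
rewrite size_flatten /shape -map_comp sumnE big_map natr_sum big_filter.
(* Tiles too long to fit are counted too, so that the full Kraft sum appears. *)
apply: (@le_trans _ _ (\sum_(v <- V) Z ^- size v * ((#|A|.*2)%:R ^+ k * Z ^+ N))).
  rewrite big_mkcond /=; apply: ler_sum => v _; case: leqP => vN; last first.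
    by apply: mulr_ge0 => //; rewrite invr_ge0 exprn_ge0// ltW.
  rewrite size_map; apply: (le_trans (IH _ _)).
  rewrite mulrCA; apply: ler_wpM2l; first exact: exprn_ge0.
  by rewrite -{2}(subnKC vN) exprD mulrA mulVf ?mul1r// expf_neq0// gt_eqF.
rewrite -mulr_suml; exact: ler_wpM2r.
Qed.

Hypothesis netP : forall x, exists a, mdist x (net a) < r.

Lemma words_cover N x : has (matches x) (words N).
Proof.
elim: N x => [//|N IH] x; have [a xa] := netP x.
have /hasP[w wN mw] := IH (T x).
apply/hasP; exists (a :: w); last by rewrite /= xa.
by apply/allpairsP; exists (a, w); rewrite /= mem_enum.
Qed.

(** Greedy parsing: a tile is used wherever one matches, and a free letter is spent only at a miss.
    The reserve [l] in the budget keeps [k >= l]. *)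
Lemma tilings_cover l f N k x : all (fun v => (0 < size v <= l)%N) V ->
  (N <= f)%N -> (occurrences (fun y => ~~ has (matches y) V) N x + l <= k)%N ->
  has (matches x) (tilings f N k).
Proof.
move=> Vl; elim: f N k x => [|f IH] N k x /= Nf Nk.
  by move: Nf; rewrite leqn0 => /eqP ->; rewrite leq0n.
case: leqP => kN; first exact: words_cover.
rewrite has_cat; have [/hasP[v vV xv]|nV] := boolP (has (matches x) V).
  apply/orP; right; have /andP[v0 vl] := allP Vl v vV.
  (* More than [k >= l] letters remain, so the tile fits. *)
  have vN : (size v <= N)%N.
    by apply: leq_trans vl _; apply: leq_trans (ltnW kN); apply: leq_trans Nk; exact: leq_addl.
  have /hasP[w wt xw] : has (matches (iter (size v) T x)) (tilings f (N - size v) k).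
    apply: IH.
      by rewrite leq_subLR; apply: (leq_trans Nf); rewrite -[f.+1]add1n leq_add2r.
    apply: leq_trans Nk; rewrite leq_add2r.
    by rewrite -[in leqRHS](subnKC vN) occurrencesD leq_addl.
  apply/hasP; exists (v ++ w); last by rewrite matches_cat xv.
  apply/flatten_mapP; exists v; first by rewrite mem_filter vN.
  by apply/mapP; exists w.
apply/orP; left; have N0 : (0 < N)%N by exact: leq_trans kN.
move: Nk Nf; rewrite -(prednK N0) occurrencesS nV add1n addSn.
case: k kN => [//|k] kN; rewrite !ltnS => Nk Nf /=.
have [a xa] := netP x; have /hasP[w wt xw] := IH _ _ _ Nf Nk.
apply/hasP; exists (a :: w); last by rewrite /= xa.
by apply/allpairsP; exists (a, w); rewrite /= mem_enum.
Qed.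

End tilings.

End words.

Lemma sum_pow3V (R : realType) n : \sum_(i < n) (3 : R) ^- i.+1 <= 2^-1.
Proof.
have -> : \sum_(i < n) (3 : R) ^- i.+1 = 2^-1 - 2^-1 * 3 ^- n.
  elim: n => [|n IH]; first by rewrite big_ord0 expr0 invr1 mulr1 subrr.
  rewrite big_ord_recr /= IH exprS invfM.
  by have : (3 : R) ^- n * 3^-1 * 3 = 3 ^- n; [rewrite mulfVK|lra].
by rewrite gerBl mulr_ge0 ?invr_ge0 ?exprn_ge0.
Qed.

(** * Blocks tiled by arbitrary codebooks *)

Section blocks.
Context {R : realType} {X : pmetricType R} (T : X -> X).
Context {A : finType} (net : A -> X) (r : R) (Z : R) (e : nat).
Hypotheses (netP : forall x, exists a, mdist x (net a) < r)
  (Z1 : 1 <= Z) (Ae : (#|A|.*2 <= 2 ^ e)%N) (e0 : (0 < e)%N).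

Definition codewords m (W : {set m.-bseq A}) : seq (seq A) :=
  [seq val w | w <- enum W].

Definition codebook m (W : {set m.-bseq A}) : bool :=
  all (fun v => 0 < size v)%N (codewords W) && (kraft (codewords W) Z <= 2^-1).

(** The first summand exceeds the length of every codeword; the second makes the blocks long enough
    to pay for the choice of a codebook. *)
Definition slack m : nat := m.+1 + #|{set m.-bseq A}|.

(* As [#|A|.*2 <= 2 ^ e], allowing [2 * slack m] free letters in a block costs a
   factor at most [2 ^ block_length m]. *)
Definition block_length m : nat := 2 * e * slack m.

(* Ranging over all codebooks makes the set of blocks independent of any
   measure, at the cost of a factor [#|{set m.-bseq A}|], which is negligible
   because of the length of the blocks. *)
Definition blocks m : seq (seq A) :=
  flatten [seq tilings (codewords W) (block_length m) (block_length m) (slack m).*2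
          | W <- [seq W <- enum {set m.-bseq A} | codebook W]].

Lemma mem_blocks m w : w \in blocks m -> size w = block_length m.
Proof. by move=> /flatten_mapP[W _ /mem_tilings]. Qed.

Let A0 : (0 < #|A|)%N.
Proof. by have [a _] := netP point; apply/card_gt0P; exists a. Qed.

Let Z0 : 0 < Z. Proof. exact: lt_le_trans Z1. Qed.

Lemma double_pow_le k : (#|A|.*2)%:R ^+ k <= 2 ^+ (e * k) :> R.
Proof. by rewrite exprM lerXn2r ?nnegrE ?exprn_ge0// -natrX ler_nat. Qed.

(** Of the factor 4, one 2 pays for the free letters and the other for the choice of a codebook. *)
Lemma size_blocks m : (size (blocks m))%:R <= (4 * Z) ^+ block_length m.
Proof.
have tW W : codebook W -> (size (tilings (codewords W) (block_length m)
    (block_length m) (slack m).*2))%:R <= (2 * Z) ^+ block_length m.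
  move=> /andP[_ kW]; apply: (le_trans (size_tilings _ _ _ A0 Z1 kW)).
  rewrite exprMn; apply: ler_wpM2r; first by rewrite exprn_ge0// ltW.
  apply: (le_trans (double_pow_le _)).
  by rewrite /block_length -mul2n mulnCA mulnA.
rewrite size_flatten /shape -map_comp sumnE big_map natr_sum big_filter.
apply: (@le_trans _ _ (\sum_(W : {set m.-bseq A}) (2 * Z) ^+ block_length m)).
  rewrite big_enum_cond /=; rewrite big_mkcond /=; apply: ler_sum => W _.
  case: ifP => [cW|_]; first exact: tW.
  by rewrite exprn_ge0// mulr_ge0// ltW.
rewrite sumr_const -[leLHS]mulr_natl.
have -> : 4 * Z = 2 * (2 * Z) by rewrite mulrA; congr (_ * _); rewrite -natrM.
rewrite [leRHS]exprMn; apply: ler_wpM2r.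
  by rewrite exprn_ge0// mulr_ge0// ltW.
apply: (@le_trans _ _ (2 ^+ #|{set m.-bseq A}|)).
  by rewrite -natrX ler_nat ltnW// ltn_expl.
rewrite ler_weXn2l ?ler1n//; rewrite /block_length /slack.
by rewrite (leq_trans (leq_addl m.+1 _))// leq_pmull// muln_gt0.
Qed.

Definition block_code M : seq (seq A) := flatten [seq blocks m | m <- iota 0 M].

Lemma mem_block_code M w :
  reflect (exists2 m, (m < M)%N & w \in blocks m) (w \in block_code M).
Proof.
apply: (iffP flatten_mapP) => -[m].
  by rewrite mem_iota add0n => mM ?; exists m.
by move=> mM ?; exists m => //; rewrite mem_iota.
Qed.

Lemma block_length_gt m : (m < block_length m)%N.
Proof.
rewrite /block_length /slack; apply: (@leq_trans (m.+1 + #|{set m.-bseq A}|)).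
  exact: leq_addr.
by rewrite leq_pmull// muln_gt0.
Qed.

(** Since [12 * Z] is three times [4 * Z], the blocks of index [m] contribute at most [3 ^- m.+1],
    whatever [M] is. *)
Lemma kraft_block_code M : kraft (block_code M) (12 * Z) <= 2^-1.
Proof.
rewrite /kraft /block_code big_flatten /= big_map.
apply: le_trans (sum_pow3V R M).
rewrite -[X in iota 0 X]subn0 -/(index_iota 0 M) big_mkord.
apply: ler_sum => m _.
rewrite big_seq (eq_bigr (fun=> (12 * Z) ^- block_length m)); last first.
  by move=> w /mem_blocks ->.
rewrite -big_seq big_const_seq iter_addr_0 count_predT -[leLHS]mulr_natl.
have Z12 : 0 < 12 * Z by rewrite mulr_gt0.
apply: (le_trans (ler_wpM2r _ (size_blocks m))).
  by rewrite invr_ge0 exprn_ge0// ltW.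
rewrite (_ : 12 * Z = 3 * (4 * Z)); last by rewrite mulrA; congr (_ * _); rewrite -natrM.
rewrite [X in _ / X]exprMn invfM mulrC mulfVK; last first.
  by rewrite expf_neq0// mulf_neq0// gt_eqF.
rewrite lef_pV2 ?posrE ?exprn_gt0// ler_weXn2l ?ler1n//.
exact: block_length_gt.
Qed.

Lemma blocks_cover m (W : {set m.-bseq A}) x : codebook W ->
  (occurrences T (fun y => ~~ has (matches T net r y) (codewords W))
    (block_length m) x <= slack m)%N ->
  has (matches T net r x) (blocks m).
Proof.
move=> cW xW; have /andP[W0 _] := cW.
have /hasP[w wt xw] : has (matches T net r x) (tilings (codewords W)
    (block_length m) (block_length m) (slack m).*2).
  apply: (@tilings_cover _ _ T _ net r _ netP m) => //.
    apply/allP => v vW; rewrite (allP W0)//=.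
    by move/mapP : vW => [u _ ->]; exact: size_bseq.
  rewrite -addnn; apply: leq_add => //.
  by rewrite /slack addSn ltnW// ltnS leq_addr.
apply/hasP; exists w => //; apply/flatten_mapP; exists W => //.
by rewrite mem_filter cW mem_enum.
Qed.

(** The blocks are themselves used as tiles. At most [N / e] free letters for the misses cost
    [2 ^ N], whence 24 instead of 12, and the reserve for the longest block costs the constant
    [c]. *)
Lemma block_code_span M : exists c : R, forall N, exists S : seq (seq A),
  [/\ (size S)%:R <= c * (24 * Z) ^+ N, {in S, forall w, size w = N} &
    forall x, (e * occurrences T
        (fun y => ~~ has (matches T net r y) (block_code M)) N x <= N)%N ->
      has (matches T net r x) S].
Proof.
(* A crude bound for the length of the longest block. *)
pose l := (\sum_(m < M) block_length m)%N.
exists ((#|A|.*2)%:R ^+ l) => N.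
exists (tilings (block_code M) N N (N %/ e + l)); split.
- have Z12 : 1 <= 12 * Z by rewrite mulr_ege1// ler1n.
  apply: (le_trans (size_tilings _ _ _ A0 Z12 (kraft_block_code M))).
  rewrite exprD mulrAC mulrC; apply: ler_wpM2l; first exact: exprn_ge0.
  rewrite (_ : 24 * Z = 2 * (12 * Z)); last by rewrite mulrA; congr (_ * _); rewrite -natrM.
  rewrite [leRHS]exprMn; apply: ler_wpM2r.
    by rewrite exprn_ge0// (le_trans _ Z12).
  apply: (le_trans (double_pow_le _)).
  by rewrite ler_weXn2l ?ler1n// mulnC leq_trunc_div.
- by move=> w /mem_tilings.
- move=> x xN; apply: (@tilings_cover _ _ T _ net r _ netP l) => //.
    apply/allP => v /mem_block_code[m mM /mem_blocks ->].
    rewrite (leq_trans _ (block_length_gt m))//=.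
    by rewrite /l (bigD1 (Ordinal mM))//= leq_addr.
  by rewrite leq_add2r leq_divRL// mulnC.
Qed.

End blocks.

(** * Feldman-Katok balls and words *)

Section min_card.
Context {R : realType} {X : choiceType}.
Implicit Types F : set (set X).

Lemma counting_seq (s : seq X) :
  (@counting X R [set` s] <= (size s)%:R%:E)%E.
Proof.
rewrite /counting asboolT; last exact: finite_seq.
rewrite lee_fin ler_nat.
apply: (@leq_trans #|` [fset x in s]%fset|).
  2: by rewrite card_fseq size_undup.
apply: fsubset_leq_card; apply/fsubsetP => x.
rewrite in_fset_set; last exact: finite_seq.
by move=> /set_mem /= xs; rewrite inE.
Qed.

Lemma min_card_le F (s : seq X) : F [set` s] ->
  (@min_card R X F <= (size s)%:R%:E)%E.
Proof.
by move=> Fs; apply: le_trans (counting_seq s); apply: ereal_inf_lbound; exists [set` s].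
Qed.

Lemma min_card_lt F (c : R) : (@min_card R X F < c%:E)%E ->
  exists2 s : seq X, F [set` s] & (size s)%:R < c.
Proof.
move=> /ereal_inf_lt[_ [E FE <-]]; rewrite /counting.
case: asboolP => // finE; rewrite lte_fin => Ec.
by exists (fset_set E) => //; rewrite fset_setK.
Qed.

End min_card.

Section FK.
Context {R : realType} {X : pmetricType R} (T : X -> X).
Implicit Types (x y z : X) (n : nat) (d eps : R).

Lemma FK_fbar_ltP n d x y : FK_fbar T n d x y < d <->
  exists (D : {set 'I_n}) p, FK_match T d x y D p /\ 1 - n%:R^-1 * #|D|%:R < d.
Proof.
rewrite /FK_fbar; split=> [|[D [p [Dp]]]].
  have P0 : (0 < #|[pred Dp : {set 'I_n} * {ffun 'I_n -> 'I_n} |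
      FK_match T d x y Dp.1 Dp.2]|)%N.
    apply/card_gt0P; exists (finset.set0, [ffun i => i]); rewrite inE /=.
    by apply/andP; split; apply/forall_inP => i; rewrite inE.
  have [[D p] /= Dp mE] := eq_bigmax_cond
    (fun Dp : {set 'I_n} * {ffun 'I_n -> 'I_n} => #|Dp.1|) P0.
  rewrite /FK_max_match mE => lt; exists D, p; split => //.
apply: le_lt_trans; rewrite lerB// ler_wpM2l ?invr_ge0// ler_nat.
exact: (@leq_bigmax_cond _ _
  (fun Dp : {set 'I_n} * {ffun 'I_n -> 'I_n} => #|Dp.1|) (D, p)).
Qed.

Lemma FK_dist_ltP n x y eps : FK_dist T n x y < eps <->
  exists d, [/\ 0 < d, d < eps & FK_fbar T n d x y < d].
Proof.
rewrite /FK_dist; set S := [set _ | _]; split=> [lt|[d [d0 de fd]]].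
  have infS : has_inf S.
    split; last by exists 0 => d [/ltW].
    (* [FK_fbar] never exceeds 1. *)
    exists 2; split => //; rewrite /FK_fbar.
    by rewrite (@le_lt_trans _ _ 1) ?ltr1n// gerBl mulr_ge0// invr_ge0.
  have [|d [d0 fd] dlt] := @inf_adherent _ S (eps - inf S) _ infS.
    by rewrite subr_gt0.
  by exists d; split => //; rewrite addrC subrK in dlt.
apply: le_lt_trans de; apply: ge_inf => //.
by exists 0 => d' [/ltW].
Qed.

Lemma FK_match_increasing n d x y (D : {set 'I_n}) p : FK_match T d x y D p ->
  {in D &, forall i j : 'I_n, (i < j)%N -> (p i < p j)%N}.
Proof.
move=> /andP[/forall_inP inc _] i j iD jD ij.
by have /forall_inP/(_ j jD)/implyP := inc i iD; exact.
Qed.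

Lemma FK_match_inj n d x y (D : {set 'I_n}) p : FK_match T d x y D p ->
  {in D &, injective p}.
Proof.
move=> /FK_match_increasing lt i j iD jD pij; apply/eqP; rewrite -val_eqE /=.
by case: (ltngtP i j) => // ij; [have := lt _ _ iD jD ij|have := lt _ _ jD iD ij];
  rewrite pij ltnn.
Qed.

(** The inverse bijection. Symmetry reconciles spanning sets, where the centre is the second
    argument of the distance, with balls, where it is the first. *)
Lemma FK_match_sym n d x y (D : {set 'I_n}) p : FK_match T d x y D p ->
  exists (D' : {set 'I_n}) p', FK_match T d y x D' p' /\ #|D'| = #|D|.
Proof.
move=> Dp; have lt := FK_match_increasing Dp; have pinj := FK_match_inj Dp.
have /andP[_ /forall_inP Dd] := Dp.
pose p' := [ffun j => odflt j [pick i in D | p i == j]].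
have p'K i : i \in D -> p' (p i) = i.
  move=> iD; rewrite ffunE; case: pickP => [k /andP[kD /eqP]|/(_ i)].
    by move/pinj => /(_ kD iD) ->.
  by rewrite iD eqxx.
exists (p @: D), p'; split; last exact: card_in_imset.
apply/andP; split; apply/forall_inP => _ /imsetP[i iD ->].
  apply/forall_inP => _ /imsetP[j jD ->]; apply/implyP; rewrite !p'K//.
  by apply: contraLR; rewrite -!leqNgt leq_eqVlt => /predU1P[/val_inj ->//|/(lt _ _ jD iD)/ltnW].
by rewrite p'K// metric_sym Dd.
Qed.

Lemma FK_dist_sym_lt n x y eps : FK_dist T n x y < eps -> FK_dist T n y x < eps.
Proof.
move=> /FK_dist_ltP[d [d0 de /FK_fbar_ltP[D [p [/FK_match_sym[D' [p' [D'p' DD']]] lt]]]]].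
apply/FK_dist_ltP; exists d; split => //; apply/FK_fbar_ltP.
by exists D', p'; rewrite DD'.
Qed.

Lemma continuous_iter n : continuous T -> continuous (iter n T).
Proof.
move=> cT; elim: n => [|n IH] x; first exact: cvg_id.
exact: (continuous_comp (IH x) (cT _)).
Qed.

(** A fixed match persists under small perturbations of [y], being a matter of finitely many strict
    inequalities. *)
Lemma open_FK_ball n x eps : continuous T -> open (FK_ball T n x eps).
Proof.
move=> cT; rewrite openE => y /= /FK_dist_ltP[d [d0 de /FK_fbar_ltP[D [p [/andP[inc /forall_inP Dd] lt]]]]].
have near_i (i : 'I_n) : \forall z \near y,
    i \in D -> mdist (iter i T x) (iter (p i) T z) < d.
  have [iD|niD] := boolP (i \in D); last by apply: nearW.
  have yd := Dd i iD.
  have nd : nbhs (iter (p i) T y) [set z | mdist (iter i T x) z < d].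
    apply/nbhs_ballP; exists (d - mdist (iter i T x) (iter (p i) T y)).
      by rewrite /= subr_gt0.
    move=> z; rewrite ballEmdist /= => yz.
    by apply: le_lt_trans (metric_triangle _ (iter (p i) T y) _) _; rewrite addrC -ltrBrDr.
  have yp := @continuous_iter (p i) cT y _ nd.
  apply: (filterS (F := nbhs y)
    (P := [set z | mdist (iter i T x) (iter (p i) T z) < d])) yp.
  by move=> z /= zd _.
have := @filter_forall _ _ _ _ (nbhs_filter y) near_i.
apply: filterS => z zD; apply/FK_dist_ltP; exists d; split => //.
apply/FK_fbar_ltP; exists D, p; split => //; apply/andP; split => //.
by apply/forall_inP => i iD; exact: zD.
Qed.

Lemma FK_Katok_le_spanning (mu : probability (borelType X) R) n delta eps :
  0 < delta -> (FK_Katok_number T mu n delta eps <= FK_spanning_number T n eps)%E.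
Proof.
move=> d0; apply: ereal_inf_le_tmp => _ [E spE <-]; exists E => //.
rewrite /= (_ : \bigcup_(x in E) _ = setT).
  by rewrite probability_setT lte_fin gtrBl.
apply/seteqP; split => // x _; have [y Ey xy] := spE x.
by exists y => //; exact: FK_dist_sym_lt.
Qed.

End FK.

Section FK_words.
Context {R : realType} {X : pmetricType R} (T : X -> X).
Context {A : finType} (net : A -> X).

Lemma matchesP r x (a0 : A) w : reflect
  (forall i, (i < size w)%N -> mdist (iter i T x) (net (nth a0 w i)) < r)
  (matches T net r x w).
Proof.
elim: w x => [|a w IH] x /=; first by constructor.
apply: (iffP andP) => [[xa /IH xw] [|i] //|xw].
  by rewrite iterSr; exact: xw.
split; first exact: (xw 0%N).
by apply/IH => i iw; rewrite -iterSr; exact: (xw i.+1).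
Qed.

(** [FK_dist < b] requires a scale strictly below [b]; finitely many strict bounds leave that
    room. *)
Lemma lt_strict_between n (f : nat -> R) b : 0 < b ->
  (forall i, (i < n)%N -> f i < b) ->
  exists d, [/\ 0 < d, d < b & forall i, (i < n)%N -> f i < d].
Proof.
move=> b0; elim: n => [|n IH] fb; first by exists (b / 2); split => //; lra.
have [i /ltnW/fb//|d [d0 db df]] := IH.
have fn := fb n (ltnSn n).
exists ((Num.max d (f n) + b) / 2).
have M1 : d <= Num.max d (f n) by rewrite le_max lexx.
have M2 : f n <= Num.max d (f n) by rewrite le_max lexx orbT.
have M3 : Num.max d (f n) < b by rewrite gt_max db.
move: (Num.max _ _) M1 M2 M3 => M M1 M2 M3.
split; [lra|lra|move=> i; rewrite ltnS leq_eqVlt => /predU1P[->|/df]; lra].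
Qed.

(** Two orbits following one word stay within [2 * r] of each other at all times, so the identity is
    a match of everything. *)
Lemma FK_dist_matches r x y (w : seq A) : (0 < size w)%N -> 0 < r ->
  matches T net r x w -> matches T net r y w -> FK_dist T (size w) x y < 2 * r.
Proof.
case: w => // a w; set w' := a :: w => w0 r0 /(matchesP _ _ a) xw /(matchesP _ _ a) yw.
have b0 : 0 < 2 * r by rewrite mulr_gt0.
have [|d [d0 db df]] :=
    @lt_strict_between (size w') (fun i => mdist (iter i T x) (iter i T y)) _ b0.
  move=> i iw; apply: le_lt_trans (metric_triangle _ (net (nth a w' i)) _) _.
  have := xw i iw; have := yw i iw; rewrite (metric_sym (iter i T y)).
  lra.
apply/FK_dist_ltP; exists d; split => //; apply/FK_fbar_ltP.
exists (finset.setTfor 'I_(size w')), [ffun i => i]; split.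
  apply/andP; split; apply/forall_inP => i _.
    by apply/forall_inP => j _; rewrite !ffunE; exact/implyP.
  by rewrite ffunE; apply: df.
by rewrite cardsT card_ord mulVf ?subrr// pnatr_eq0.
Qed.

Lemma enum_ord_sorted n (D : {set 'I_n}) :
  sorted (fun i j : 'I_n => (i < j)%N) (enum D).
Proof.
have -> : enum D = [seq i <- Finite.enum 'I_n | i \in D] by [].
have : sorted (fun i j : 'I_n => (i < j)%N) (Finite.enum 'I_n).
  have := iota_ltn_sorted 0 n; rewrite -val_enum_ord enumT sorted_map.
  by [].
apply: sorted_filter => i j k; exact: ltn_trans.
Qed.

(** This is why an increasing bijection can be recovered from its domain and range alone. *)
Lemma enum_imset_increasing n (D : {set 'I_n}) (p : {ffun 'I_n -> 'I_n}) :
  {in D &, forall i j : 'I_n, (i < j)%N -> (p i < p j)%N} ->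
  enum (p @: D)%SET = map p (enum D).
Proof.
move=> lt; apply: (@irr_sorted_eq _ (fun i j : 'I_n => (i < j)%N)).
- by move=> i j k; exact: ltn_trans.
- by move=> i; exact: ltnn.
- exact: enum_ord_sorted.
- rewrite sorted_map; have := enum_ord_sorted D.
  apply: sub_in_sorted; last exact: (introT allP (fun i => id)).
  by move=> i j; rewrite !mem_enum => iD jD; exact: lt.
- move=> j; rewrite mem_enum; apply/imsetP/mapP => -[i iD ->]; exists i => //.
    by rewrite mem_enum.
  by rewrite mem_enum in iD.
Qed.

End FK_words.

(** * Covering Feldman-Katok balls by words *)

Section FK_ball_words.
Context {R : realType} {X : pmetricType R} (T : X -> X).
Context {A : finType} (net : A -> X) (eps : R).
Hypothesis netP : forall x, exists a, mdist x (net a) < eps.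

(* A match between the orbits of [z] and [y] is determined by its domain [D]
   and its range [E]; on [E] the letters of a word followed by [y] can be read
   off the orbit of [z], and [u] lists the remaining letters. *)
Definition FK_word (c : X -> A) z n k (D E : {set 'I_n}) (u : k.-tuple A) : seq A :=
  [seq if j \in E then c (iter (nth j (enum D) (index j (enum E))) T z)
       else nth (c z) u (index j (enum (~: E)%SET)) | j <- enum 'I_n].

(** There are [4 ^ n] pairs of a domain and a range, and [k] bounds the number of unmatched times.
    The radius doubles: one [eps] for the match, one for the net. *)
Lemma FK_ball_words n k z : (0 < n)%N -> k = Num.truncn (eps * n%:R) ->
  exists S : seq (seq A), [/\ size S = (4 ^ n * #|A| ^ k)%N,
    {in S, forall w, size w = n} &
    forall y, FK_dist T n z y < eps -> has (matches T net (2 * eps) y) S].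
Proof.
move=> n0 kE; have [c cP] := choice netP.
exists [seq FK_word c z DEu.1.1 DEu.1.2 DEu.2
  | DEu : ({set 'I_n} * {set 'I_n} * k.-tuple A)%type]; split.
- rewrite size_map -cardE !card_prod card_tuple.
  by rewrite -!cardsT -!powersetT !card_powerset cardsT card_ord -expnMn.
- by move=> _ /mapP[DEu _ ->]; rewrite size_map size_enum_ord.
move=> y /FK_dist_ltP[d [d0 de /FK_fbar_ltP[D [p [Dp lt]]]]].
have pinj := FK_match_inj Dp; have pinc := FK_match_increasing Dp.
have /andP[_ /forall_inP Dd] := Dp.
pose E := (p @: D)%SET.
have Ek : (#|~: E|%SET <= k)%N.
  have cE : #|E| = #|D| by exact: card_in_imset.
  have nE : (#|E| + #|~: E|%SET = n)%N by rewrite cardsC card_ord.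
  rewrite kE truncn_ge_nat; last first.
    by rewrite mulr_ge0// (le_trans (ltW d0) (ltW de)).
  have nER : #|E|%:R + #|~: E|%SET%:R = n%:R :> R by rewrite -natrD nE.
  have -> : #|~: E|%SET%:R = n%:R - #|D|%:R :> R by rewrite -cE -nER addrC addKr.
  have n0R : 0 < n%:R :> R by rewrite ltr0n.
  rewrite -ler_pdivrMr// mulrBl mulfV ?gt_eqF// mulrC.
  exact: ltW (lt_trans lt de).
(* Letters of [y] at the unmatched times, in order; the default time 0 only pads the tuple to length
   [k]. *)
pose u := [tuple c (iter (nth 0%N [seq val i | i <- enum (~: E)%SET] l) T y) | l < k].
apply/hasP; exists (FK_word c z D E u).
  by apply/mapP; exists (D, E, u); rewrite ?mem_enum.
apply/(matchesP _ _ _ _ (c z)) => i; rewrite size_map size_enum_ord => iltn.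
pose j := Ordinal iltn.
rewrite (nth_map j) ?size_enum_ord// -[X in nth j _ X]/(val j) nth_ord_enum.
case: ifPn => [/imsetP[i' i'D jE]|jE].
  rewrite (enum_imset_increasing pinc) jE nth_index_map ?mem_enum//; last first.
    by move=> a b; rewrite !mem_enum; exact: pinj.
  have -> : i = p i' by rewrite -jE.
  apply: le_lt_trans (metric_triangle _ (iter i' T z) _) _.
  have := Dd _ i'D; have := cP (iter i' T z); rewrite (metric_sym (iter (p i') T y)).
  lra.
have jE' : j \in enum (~: E)%SET by rewrite mem_enum inE.
have idx : (index j (enum (~: E)%SET) < k)%N.
  by apply: leq_trans Ek; rewrite cardE index_mem.
rewrite -[index _ _]/(val (Ordinal idx)) nth_mktuple /=.
rewrite (nth_map j) ?index_mem// nth_index//.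
apply: (lt_le_trans (cP _)); rewrite ler_peMl ?ler1n//.
exact: le_trans (ltW d0) (ltW de).
Qed.


End FK_ball_words.

(** * Codebooks of ergodic measures *)

Lemma sum_pow2V (R : realType) n0 n : \sum_(i < n) (2 : R) ^- (n0 + i) <= 2 * 2 ^- n0.
Proof.
have -> : \sum_(i < n) (2 : R) ^- (n0 + i) = 2 * 2 ^- n0 - 2 * 2 ^- (n0 + n).
  elim: n => [|n IH]; first by rewrite big_ord0 addn0 subrr.
  rewrite big_ord_recr /= IH addnS exprS invfM.
  by have : 2 * (2^-1 * 2 ^- (n0 + n)) = (2 : R) ^- (n0 + n); [rewrite mulVKf|lra].
by rewrite gerBl mulr_ge0 ?invr_ge0 ?exprn_ge0.
Qed.

Section invariance.
Context {R : realType} {X : pmetricType R} (T : X -> X) (hT : homeomorphism T).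
Variable mu : probability (borelType X) R.
Hypothesis muT : invariant_measure T mu.

Let cT : continuous T. Proof. by case: hT. Qed.

Lemma borel_preimage_iter n (A : set (borelType X)) : measurable A ->
  measurable (iter n T @^-1` A : set (borelType X)).
Proof. by move=> mA; apply: borel_preimage => //; exact: continuous_iter. Qed.

Lemma invariant_measure_iter n (A : set (borelType X)) : measurable A ->
  mu (iter n T @^-1` A) = mu A.
Proof.
move=> mA; elim: n => [//|n IH]; rewrite -[RHS]IH -[RHS]muT.
  by congr (mu _); apply/seteqP; split => x /=; rewrite -iterS iterSr.
exact: borel_preimage_iter.
Qed.

Lemma measurable_has_matches (A : finType) (net : A -> X) r (W : seq (seq A)) :
  measurable ([set x | has (matches T net r x) W] : set (borelType X)).
Proof.
have -> : [set x | has (matches T net r x) W] =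
    \bigcup_(w in [set` W]) [set x | matches T net r x w].
  by apply/seteqP; split => x /= => [/hasP[w wW xw]|[w wW xw]]; [exists w|apply/hasP; exists w].
apply: sub_sigma_algebra; apply: bigcup_open => w _; exact: open_matches.
Qed.

(** Markov's inequality for the number of visits, whose integral is [N] times the measure of the set
    by invariance. *)
Lemma occurrences_markov (P : pred X) N j :
  measurable ([set x | P x] : set (borelType X)) ->
  measurable ([set x | (j <= occurrences T P N x)%N] : set (borelType X)) /\
  (j%:R%:E * mu [set x | (j <= occurrences T P N x)%N] <=
   N%:R%:E * mu [set x | P x])%E.
Proof.
move=> mP; set E := [set x | _].
pose B t : set (borelType X) := iter t T @^-1` [set x | P x].
have mB t : measurable (B t) by exact: borel_preimage_iter.
pose f (x : borelType X) : R := \sum_(t < N) \1_(B t) x.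
have fE x : f x = (occurrences T P N x)%:R.
  rewrite /f /occurrences natr_sum; apply: eq_bigr => t _.
  rewrite indicE; congr (_%:R); congr nat_of_bool.
  by apply/idP/idP => [/set_mem|Pt]; [|exact/mem_set].
have mf : measurable_fun setT f.
  by apply: measurable_sum => t; exact: measurable_indic.
have mE : measurable (E : set (borelType X)).
  have -> : E = f @^-1` `[j%:R, +oo[.
    by apply/seteqP; split => x /=; rewrite /E /= in_itv /= andbT fE ler_nat.
  by rewrite -[X in measurable X]setTI; apply: mf => //; exact: measurable_itv.
split => //.
have -> : (N%:R%:E * mu [set x | P x] = \int[mu]_x (f x)%:E)%E.
  under eq_integral do rewrite /f -sumEFin.
  rewrite ge0_integral_sum//; last first.
    by move=> t; apply/measurable_EFinP; exact: measurable_indic.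
  rewrite (eq_bigr (fun=> mu [set x | P x])); last first.
    by move=> t _; rewrite integral_indic// setIT; exact: invariant_measure_iter.
  by rewrite sumr_const card_ord mule_natl.
apply: (@le_trans _ _ (\int[mu]_(x in E) (j%:R)%:E)%E).
  by rewrite integral_cst.
apply: (@le_trans _ _ (\int[mu]_(x in E) (f x)%:E)%E).
  apply: ge0_le_integral => //.
  - by apply/measurable_EFinP; exact: measurable_funS mf.
  - by move=> x Ex; rewrite lee_fin fE ler_nat.
apply: ge0_subset_integral => //; first by apply/measurable_EFinP.
by move=> x _; rewrite lee_fin fE.
Qed.

End invariance.

Lemma uniq_ler_sum (R : numDomainType) (I : eqType) (s1 s2 : seq I) (F : I -> R) :
  (forall i, 0 <= F i) -> uniq s1 -> {subset s1 <= s2} ->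
  \sum_(i <- s1) F i <= \sum_(i <- s2) F i.
Proof.
move=> F0; elim: s1 s2 => [|x s1 IH] s2 /=; first by rewrite big_nil sumr_ge0.
move=> /andP[xs1 us1] s12; rewrite big_cons [leRHS](big_rem x) ?s12 ?mem_head//=.
rewrite lerD2l; apply: IH => // y ys1; apply: rem_mem.
  by apply: contraNneq xs1 => <-.
by apply: s12; rewrite inE ys1 orbT.
Qed.

(** * Words along forward orbits and their Kraft sums *)

Section ergodic_codebooks.
Context {R : realType} {X : pmetricType R} (T : X -> X) (hT : homeomorphism T).
Context {A : finType} (net : A -> X) (r : R) (a : R).
Hypothesis a1 : 1 <= a.

Local Notation hit W := [set x | has (matches T net r x) W].

(** The form in which a bound on the Katok entropy is used once FK balls have been replaced by
    words. *)
Definition coverable (mu : probability (borelType X) R) (delta : R) : Prop :=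
  exists n0 (W : nat -> seq (seq A)), forall n, (n0 <= n)%N ->
    [/\ {in W n, forall w, size w = n}, (size (W n))%:R <= a ^+ n &
        ((1 - delta)%:E <= mu (hit (W n)))%E].

Let Z := 2 * a.

Let Z0 : 0 < Z. Proof. by rewrite mulr_gt0// (lt_le_trans _ a1). Qed.

Lemma cvg_gt_eventually (u : nat -> \bar R) (l : \bar R) c :
  u n @[n --> \oo] --> l -> (c < l)%E -> exists n, (c < u n)%E.
Proof.
move=> ul cl; have : nbhs l [set y | (c < y)%E].
  by apply: open_nbhs_nbhs; split => //; exact: open_ereal_gt_ereal.
by move=> /ul [n _ /(_ n (leqnn n))]; exists n.
Qed.

Lemma limsup_hit_ge (mu : probability (borelType X) R) (M : nat -> set X) n0 c :
  (forall n, measurable (M n : set (borelType X))) ->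
  (forall n, (n0 <= n)%N -> (c <= mu (M n))%E) ->
  (c <= mu (lim_sup_set M))%E.
Proof.
move=> mM cM.
have mG n : measurable (\bigcup_(j >= n) M j : set (borelType X)).
  by apply: bigcup_measurable => j _; exact: mM.
have cvg : mu (\bigcup_(j >= n) M j) @[n --> \oo] --> mu (lim_sup_set M).
  apply: nonincreasing_cvg_mu => //.
  - by rewrite (le_lt_trans (probability_le1 _ (mG 0%N))) ?ltry.
  - exact: bigcapT_measurable.
  - move=> i j ij; apply/subsetPset => x [k /= jk Mk]; exists k => //=.
    exact: leq_trans jk.
rewrite leNgt; apply/negP => lt.
have : nbhs (mu (lim_sup_set M)) [set y | (y < c)%E].
  by apply: open_nbhs_nbhs; split => //; exact: open_ereal_lt_ereal.
move=> /cvg[n _ /(_ (maxn n n0) (leq_maxl _ _))] /=.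
apply/negP; rewrite -leNgt; apply: (@le_trans _ _ (mu (M (maxn n n0)))); first exact/cM/leq_maxr.
apply: le_measure; rewrite ?inE; [exact: mM|exact: mG|].
by move=> x Mx; exists (maxn n n0) => //=.
Qed.

(** A point of the union is reached in [s] steps from a point of [E]. Forward orbits are what is
    needed: if the earlier point follows a word, the later one follows a suffix of it. *)
Lemma ergodic_forward_orbits (mu : probability (borelType X) R) (T' : X -> X)
    (E : set (borelType X)) :
  cancel T T' -> cancel T' T -> continuous T' -> ergodic_measure T mu ->
  measurable E -> (0 < mu E)%E ->
  mu (\bigcup_s (iter s T' @^-1` E)) = 1%E.
Proof.
move=> TK T'K cT' [muT erg] mE E0; set B := bigcup _ _.
have [cT _] := hT.
have mB : measurable (B : set (borelType X)).
  apply: bigcupT_measurable => s; apply: borel_preimage => //.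
  exact: continuous_iter.
have BT x : B x -> B (T x).
  by move=> [s _ Es]; exists s.+1 => //; rewrite /preimage /= -iterS iterSr TK.
(* [B] is forward invariant, so the union of its preimages is invariant and has
   the same measure. *)
pose C := \bigcup_k (iter k T @^-1` B).
have mC : measurable (C : set (borelType X)).
  by apply: bigcupT_measurable => s; exact: borel_preimage_iter.
have TC : T @^-1` C = C.
  apply/seteqP; split=> x /= [k _ Bk].
    by exists k.+1 => //; rewrite /preimage /= -iterS iterSr.
  by exists k => //; rewrite /preimage /= -iterSr iterS; exact: BT.
have muC : mu C = mu B.
  have cvg : mu (iter k T @^-1` B) @[k --> \oo] --> mu C.
    apply: nondecreasing_cvg_mu => //; first by move=> k; exact: borel_preimage_iter.
    move=> i j /subnK <-; apply/subsetPset; elim: (j - i)%N => [//|l IH].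
    by move=> x /IH /BT.
  apply/esym; apply: (cvg_unique _ _ cvg) => //.
  rewrite (_ : (fun _ => _) = fun=> mu B); first exact: cvg_cst.
  by apply/funext => k; exact: invariant_measure_iter.
have [C0|] := erg C mC TC; last by rewrite muC.
have : (mu E <= mu C)%E.
  rewrite muC; apply: le_measure; rewrite ?inE//.
  by move=> x Ex; exists 0%N.
by rewrite C0 leNgt E0.
Qed.

Definition shifted_words (W : nat -> seq (seq A)) k n0 m : seq (seq A) :=
  [seq drop s w | s <- iota 0 k, w <- flatten [seq W n | n <- iota n0 m]].

Lemma mem_shifted_words W k n0 m v :
  (forall n, (n0 <= n)%N -> {in W n, forall w, size w = n}) ->
  (k <= n0)%N -> v \in shifted_words W k n0 m -> (0 < size v <= n0 + m)%N.
Proof.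
move=> sW kn /allpairsP[[s w] /= [sk /flatten_mapP[n]]].
move: sk; rewrite !mem_iota add0n => /= sk /andP[n0n nm] /(sW n n0n) wn ->.
rewrite size_drop wn subn_gt0 (leq_trans sk (leq_trans kn n0n)) /=.
by rewrite (leq_trans (leq_subr _ _))// ltnW.
Qed.

(** With [Z = 2 * a], the at most [a ^ n] words of length [n] cut by [s] letters weigh at most
    [Z ^ s * 2 ^- n]. This is summed as a geometric tail over [n >= n0] and over the [k] values of
    [s], uniformly in [m]. *)
Lemma kraft_shifted_words W k n0 m :
  (forall n, (n0 <= n)%N ->
    {in W n, forall w, size w = n} /\ (size (W n))%:R <= a ^+ n) ->
  (k <= n0)%N ->
  kraft (shifted_words W k n0 m) Z <= k%:R * Z ^+ k * (2 * 2 ^- n0).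
Proof.
move=> WP kn; rewrite /kraft /shifted_words big_allpairs_dep /=.
rewrite -[X in iota 0 X]subn0 -/(index_iota 0 k) big_mkord -mulrA mulr_natl.
rewrite -[k in leRHS]card_ord -sumr_const; apply: ler_sum => s _.
rewrite big_flatten /= big_map.
rewrite -[n0 in iota n0 _]addn0 iotaDl big_map.
rewrite -[X in iota 0 X]subn0 -/(index_iota 0 m) big_mkord.
apply: le_trans (ler_wpM2l _ (sum_pow2V R n0 m)); last first.
  by rewrite exprn_ge0// ltW.
rewrite mulr_sumr; apply: ler_sum => i _.
have [sW cW] := WP (n0 + i)%N (leq_addr _ _).
have sn : (s <= n0 + i)%N by rewrite (leq_trans (ltnW (ltn_ord s)))// (leq_trans kn)// leq_addr.
rewrite big_seq (eq_bigr (fun=> Z ^- (n0 + i - s))); last first.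
  by move=> w /sW wn; rewrite size_drop wn.
rewrite -big_seq big_const_seq iter_addr_0 count_predT -[leLHS]mulr_natl.
apply: (le_trans (ler_wpM2r _ cW)); first by rewrite invr_ge0 exprn_ge0// ltW.
have a0 : 0 < a by exact: lt_le_trans a1.
apply: (@le_trans _ _ (Z ^+ s * 2 ^- (n0 + i))).
  have -> : 2 ^- (n0 + i) = a ^+ (n0 + i) * Z ^- (n0 + i) :> R.
    by rewrite /Z exprMn invfM mulrCA mulfV ?mulr1// expf_neq0// gt_eqF.
  rewrite mulrCA; apply: ler_wpM2l; first by rewrite exprn_ge0// ltW.
  rewrite -{2}(subnKC sn) exprD invfM mulrA mulfV ?mul1r// expf_neq0// gt_eqF//.
apply: ler_wpM2r; first by rewrite invr_ge0 exprn_ge0.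
rewrite ler_weXn2l ?card_ord ?(ltnW (ltn_ord s))//.
by rewrite /Z mulr_ege1// ler1n.
Qed.

(** Turning a list into a set removes repetitions, which can only lower the Kraft sum. *)
Lemma codebook_of_seq (V : seq (seq A)) m : all (fun v => 0 < size v <= m)%N V ->
  kraft V Z <= 2^-1 ->
  exists2 W : {set m.-bseq A}, codebook Z W & codewords W =i V.
Proof.
move=> /allP Vm kV.
pose W := finset (fun w : m.-bseq A => val w \in V).
have WV : codewords W =i V.
  move=> v; apply/mapP/idP => [[w + ->]|vV]; first by rewrite mem_enum inE.
  have /andP[_ vm] := Vm v vV.
  by exists (Bseq vm) => //; rewrite mem_enum inE.
exists W => //; apply/andP; split.
  by apply/allP => v; rewrite WV => /Vm/andP[].
apply: le_trans kV; rewrite /kraft.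
apply: uniq_ler_sum => [v||v]; last by rewrite WV.
  by rewrite invr_ge0 exprn_ge0// ltW.
by rewrite map_inj_uniq ?enum_uniq//; exact: val_inj.
Qed.

End ergodic_codebooks.

(** * Blocks for ergodic measures and uniform coding of long orbits *)

Section ergodic_blocks.
Context {R : realType} {X : pmetricType R} (T : X -> X) (hT : homeomorphism T).
Context (cptX : compact [set: X]).
Context {A : finType} (net : A -> X) (r : R) (a : R).
Hypothesis a1 : 1 <= a.

Local Notation hit W := [set x | has (matches T net r x) W].
Local Notation miss W := (fun x => ~~ has (matches T net r x) W).

Let cT : continuous T. Proof. by case: hT. Qed.

Let Z := 2 * a.

Let Z1 : 1 <= Z. Proof. by rewrite mulr_ege1// ler1n. Qed.

Lemma measurable_miss W : measurable ([set x | miss W x] : set (borelType X)).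
Proof.
rewrite (_ : [set x | _] = ~` hit W); last first.
  by apply/seteqP; split => x /= /negP.
by apply: measurableC; exact: measurable_has_matches.
Qed.

Lemma probability_miss (mu : probability (borelType X) R) W d :
  ((1 - d)%:E < mu (hit W))%E -> (mu [set x | miss W x] < d%:E)%E.
Proof.
move=> lt; rewrite (_ : [set x | _] = ~` hit W); last first.
  by apply/seteqP; split => x /= /negP.
have mW := measurable_has_matches hT net r W.
rewrite probability_setC// -(fineK (fin_num_measure mu _ mW)) in lt *.
by rewrite -EFinB lte_fin ltrBlDr -ltrBlDl -lte_fin.
Qed.

(** Three choices in order: [k] so that [k] steps forward from the limsup set nearly fill the space,
    [n0] so that the Kraft sum is small, and finally [m] so that finitely many word lengths
    suffice. *)
Lemma ergodic_codebook (mu : probability (borelType X) R) delta d :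
  ergodic_measure T mu -> delta < 1 -> coverable T net r a mu delta -> 0 < d ->
  exists m (W : {set m.-bseq A}), codebook Z W /\
    (mu [set x | miss (codewords W) x] < d%:E)%E.
Proof.
move=> muE d1 [n1 [W WP]] d0.
have [_ [T' [TK T'K cT']]] := hT.
pose M n : set X := hit (W n).
have mM n : measurable (M n : set (borelType X)) by exact: measurable_has_matches.
pose E : set (borelType X) := lim_sup_set M.
have mE : measurable E.
  by apply: bigcapT_measurable => n; apply: bigcup_measurable => j _; exact: mM.
have E0 : (0 < mu E)%E.
  apply: (@lt_le_trans _ _ (1 - delta)%:E); first by rewrite lte_fin subr_gt0.
  by apply: (@limsup_hit_ge _ _ _ _ n1) => // n /WP[].
have muB := ergodic_forward_orbits hT TK T'K cT' muE mE E0.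
pose F k : set (borelType X) := \bigcup_(s < k) (iter s T' @^-1` E).
have mTE s : measurable (iter s T' @^-1` E : set (borelType X)).
  by apply: borel_preimage => //; exact: continuous_iter.
have mF k : measurable (F k) by apply: bigcup_measurable.
have cF : mu (F k) @[k --> \oo] --> 1%E.
  rewrite -muB (_ : \bigcup_s _ = \bigcup_k F k); last first.
    apply/seteqP; split=> x [s _]; first by move=> Es; exists s.+1 => //; exists s => /=.
    by move=> [i _ Ei]; exists i.
  apply: nondecreasing_cvg_mu => //; first exact: bigcupT_measurable.
  move=> i j ij; apply/subsetPset => x [s /= si Es]; exists s => //=.
  exact: leq_trans ij.
have [|k Fk] := cvg_gt_eventually (c := (1 - d)%:E) cF.
  by rewrite lte_fin gtrBl.
(* At least [k], so that shifted words are nonempty, and large enough that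
   [4 * (k * Z ^ k) <= 2 ^ n0], which brings the Kraft bound down to 1/2. *)
pose n0 := maxn n1 (k + (Num.truncn (4 * (k%:R * Z ^+ k))).+1).
have kn0 : (k <= n0)%N by rewrite leq_max leq_addr orbT.
have WP' n : (n0 <= n)%N -> {in W n, forall w, size w = n} /\ (size (W n))%:R <= a ^+ n.
  by move=> n0n; have [] := WP n (leq_trans (leq_maxl _ _) n0n).
pose V m := shifted_words W k n0 m.
pose H m : set (borelType X) := hit (V m).
have mH m : measurable (H m) by exact: measurable_has_matches.
have FH : F k `<=` \bigcup_m H m.
  move=> x [s /= sk Es]; have [n /= n0n Mn] := Es n0 I.
  (* The successor makes the half-open window of lengths from [n0] include [n]. *)
  have {Mn} /hasP[w wW yw] := Mn; exists (n - n0).+1 => //.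
  apply/hasP; exists (drop s w).
    apply/allpairsP; exists (s, w); split => //; first by rewrite mem_iota.
    apply/flatten_mapP; exists n => //.
    by rewrite mem_iota n0n addnS subnKC//=.
  have := @matches_drop _ _ _ _ net r s _ _ yw.
  suff -> : iter s T (iter s T' x) = x by [].
  by elim: (s) => [//|i IH]; rewrite iterSr iterS T'K.
have cH : mu (H m) @[m --> \oo] --> mu (\bigcup_m H m).
  apply: nondecreasing_cvg_mu => //; first exact: bigcupT_measurable.
  move=> i j ij; apply/subsetPset => x /hasP[v /allpairsP[[s w] /= [sk /flatten_mapP[n + wn ->]]] xw].
  rewrite mem_iota => /andP[n0n ni]; apply/hasP; exists (drop s w) => //.
  apply/allpairsP; exists (s, w); split => //=; apply/flatten_mapP; exists n => //.
  by rewrite mem_iota n0n (leq_trans ni)// leq_add2l.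
have [|m Hm] := cvg_gt_eventually (c := (1 - d)%:E) cH.
  apply: (lt_le_trans Fk); apply: le_measure; rewrite ?inE//.
  exact: bigcupT_measurable.
have [||U cU UV] := @codebook_of_seq _ _ a a1 (V m) (n0 + m).
- apply/allP => v; apply: mem_shifted_words => // n /WP'[]//.
- apply: (le_trans (kraft_shifted_words a1 _ WP' kn0)).
  have : 4 * (k%:R * Z ^+ k) <= 2 ^+ n0.
    apply: ltW; apply: (lt_le_trans (truncnS_gt _)).
    rewrite -natrX ler_nat; apply: (leq_trans _ (ltnW (ltn_expl n0 (ltnSn 1)))).
    by rewrite /n0 leq_max leq_addl orbT.
  have p0 : 0 < 2 ^+ n0 :> R by exact: exprn_gt0.
  rewrite -/Z; move: (k%:R * _) p0 => y p0 yp.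
  by rewrite mulrA ler_pdivrMr//; lra.
exists (n0 + m)%N, U; split => //.
apply: probability_miss; apply: (lt_le_trans Hm).
apply: le_measure; rewrite ?inE//; first exact: measurable_has_matches.
by move=> x /=; rewrite /H /= (eq_has_r UV).
Qed.

Variable e : nat.
Hypotheses (netP : forall x, exists b, mdist x (net b) < r) (e0 : (0 < e)%N).

(** A point starting no block sees more than [slack m] misses of the codebook within
    [block_length m = 2 * e * slack m] steps. With misses of measure below [c / (2 * e)], Markov's
    inequality gives such points measure below [c]. *)
Lemma ergodic_blocks (mu : probability (borelType X) R) delta c :
  ergodic_measure T mu -> delta < 1 -> coverable T net r a mu delta -> 0 < c ->
  exists m, (mu [set x | miss (@blocks R A Z e m) x] < c%:E)%E.
Proof.
move=> muE d1 cov c0; have [muT _] := muE.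
have e20 : 0 < (2 * e)%:R :> R by rewrite ltr0n muln_gt0.
have d0 : 0 < c / (2 * e)%:R by rewrite divr_gt0.
have [m [W [cW muW]]] := ergodic_codebook muE d1 cov d0.
exists m; set Bad := [set x | _] in muW.
have [mO] := occurrences_markov hT muT (@block_length A e m) (@slack A m).+1
  (measurable_miss (codewords W)).
set O := [set x | _] in mO *; move=> markov.
apply: (@le_lt_trans _ _ (mu O)).
  apply: le_measure; rewrite ?inE//; first exact: measurable_miss.
  move=> x /=; rewrite /O /=; apply: contraR; rewrite -ltnNge ltnS => xW.
  exact: (blocks_cover netP cW xW).
have fO : mu O \is a fin_num by exact: fin_num_measure.
have fB : mu Bad \is a fin_num by apply: fin_num_measure; exact: measurable_miss.
move: markov muW; rewrite -/Bad -(fineK fO) -(fineK fB) -!EFinM !lee_fin !lte_fin.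
have B0 : 0 <= fine (mu Bad) by rewrite fine_ge0.
move: (fine (mu Bad)) (fine (mu O)) B0 => y z y0.
rewrite /block_length natrM; have s0 : 0 < (@slack A m)%:R :> R by rewrite ltr0n.
rewrite ltr_pdivlMr// -natr1; move: ((2 * e)%:R) ((@slack A m)%:R) e20 s0 => u s u0 s0 zs yu.
rewrite ltNge; apply/negP => cz.
have : (s + 1) * c <= (s + 1) * z by apply: ler_wpM2l => //; lra.
have : s * (y * u) < s * c by rewrite ltr_pM2l.
nra.
Qed.

Lemma eventually_coded delta : delta < 1 ->
  (forall mu : probability (borelType X) R, ergodic_measure T mu ->
    coverable T net r a mu delta) ->
  exists M N0, forall N x, (N0 <= N)%N ->
    (e * occurrences T (miss (@block_code R A Z e M)) N x <= N)%N.
Proof.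
move=> d1 cov; apply: contrapT => /forallNP no.
(* The orbit refuting [M] is longer than [M], so these lengths tend to infinity, as invariance of
   the limit requires. *)
have /choice[Nx NxP] M : exists Nx : nat * X, (M.+1 <= Nx.1)%N /\
    (Nx.1 < e * occurrences T (miss (@block_code R A Z e M)) Nx.1 Nx.2)%N.
  have := no M => /forallNP/(_ M.+1) /existsNP[N /existsNP[x]] /not_implyP[MN].
  by move=> /negP; rewrite -ltnNge => lt; exists (N, x).
have eR : 0 < e%:R :> R by rewrite ltr0n.
pose K M : set X := [set x | miss (@block_code R A Z e M) x].
have cK M : closed (K M).
  rewrite -[K M]setCK; apply: open_closedC.
  rewrite (_ : ~` K M = \bigcup_(w in [set` @block_code R A Z e M]) [set x | matches T net r x w]).
    by apply: bigcup_open => w _; exact: open_matches.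
  apply/seteqP; split => x /=; rewrite /K /=.
    by move=> /negP/negPn/hasP[w wW xw]; exists w.
  by move=> [w wW xw]; apply/negP/negPn/hasP; exists w.
have [||j|mu muT muK] := @invariant_measure_of_frequency R X cptX T hT K
    (fun M => (Nx M).2) (fun M => (Nx M).1) (e%:R^-1) cK.
- move=> i j ij; apply/subsetPset => x; apply: contra => /hasP[w /mem_block_code[m mi wm] xw].
  by apply/hasP; exists w => //; apply/mem_block_code; exists m => //; exact: leq_trans ij.
- by move=> j; have [] := NxP j.
- have [N0 lt] := NxP j; rewrite /empirical.
  have NR : 0 < (Nx j).1%:R :> R by rewrite ltr0n (leq_trans _ N0).
  rewrite [leRHS]mulrC ler_pdivlMr// mulrC ler_pdivrMr//.
  apply: ltW; move: lt; rewrite -(ltr_nat R) natrM mulrC => /lt_le_trans; apply.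
  rewrite ler_wpM2r// natr_sum; apply: ler_sum => t _.
  rewrite ler_nat; case: (boolP (~~ _)) => // miss_t.
  by rewrite mem_set.
have cKK : closed (\bigcap_j K j) by apply: closed_bigI => j _.
have [nu nuE nuK] := ergodic_measure_closed cptX hT cKK muT muK.
(* Misses have frequency at least [e^-1] along the orbits, and [nu] inherits this as a mass; yet the
   blocks of a single index [m] are already missed with smaller probability. *)
have [|m] := ergodic_blocks nuE d1 (cov nu nuE) (_ : 0 < e%:R^-1).
  by rewrite invr_gt0.
apply/negP; rewrite -leNgt; apply: (le_trans nuK).
apply: le_measure; rewrite ?inE//.
- exact: borel_closed.
- exact: measurable_miss.
- move=> x /(_ m.+1 I); apply: contra => /hasP[w wm xw].
  by apply/hasP; exists w => //; apply/mem_block_code; exists m.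
Qed.

End ergodic_blocks.

(** * Exponential rates *)

Section exponential_rates.
Context {R : realType}.
Implicit Types (x y : \bar R) (t h : R).
Local Open Scope ereal_scope.

Lemma lne_rate_lt t h x : (0 < t)%R -> t%:E * lne x < h%:E ->
  x < (expR (t^-1 * h))%:E.
Proof.
move=> t0; case: x => [u| |] /=; last by rewrite ltNyr.
  case: ifPn => [u0 _|]; first by rewrite lte_fin (le_lt_trans u0)// expR_gt0.
  rewrite -ltNge -EFinM !lte_fin => u0 lt.
  by rewrite -[ltLHS](lnK u0) ltr_expR mulrC ltr_pdivlMr// mulrC.
by rewrite gt0_muley ?lte_fin// ltNge leey.
Qed.

Lemma lne_rate_le t h x : (0 < t)%R -> x <= (expR (t^-1 * h))%:E ->
  t%:E * lne x <= h%:E.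
Proof.
move=> t0; case: x => [u| |] /=; last by move=> _; rewrite gt0_muleNy ?lte_fin// leNye.
  case: ifPn => [u0 _|]; first by rewrite gt0_muleNy ?lte_fin// leNye.
  rewrite -ltNge -EFinM !lee_fin => u0.
  by rewrite -[leLHS](lnK u0) ler_expR mulrC ler_pdivlMr// mulrC.
by rewrite leye_eq.
Qed.

Lemma le_lne x y : x <= y -> lne x <= lne y.
Proof.
case: x => [u| |] /=; last by move=> _; rewrite leNye.
  case: y => [v| |] /=; last by rewrite leeNy_eq.
    rewrite lee_fin; case: ifPn => [_ _|u0]; first by rewrite leNye.
    case: ifPn => [v0 uv|]; first by rewrite (le_trans uv v0) in u0.
    by rewrite -!ltNge in u0 * => v0 uv; rewrite lee_fin ler_ln.
  by move=> _; rewrite leey.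
by rewrite leye_eq => /eqP ->.
Qed.

End exponential_rates.

(** * Limits superior on the logarithmic scale *)

Section limits_superior.
Context {R : realType}.
Local Open Scope ereal_scope.

Lemma limf_esup_le_near (U : choiceType) (V : filteredType U) (F : set_system V)
    (f g : V -> \bar R) : Filter F ->
  (\forall x \near F, f x <= g x) -> limf_esup f F <= limf_esup g F.
Proof.
move=> FF fg; rewrite !limf_esupE; apply: le_ereal_inf_tmp => _ [W FW <-].
apply: (@le_trans _ _ (ereal_sup (f @` (W `&` [set x | f x <= g x])))).
  by apply: ereal_inf_lbound; exists (W `&` [set x | f x <= g x]) => //; exact: filterI.
apply: ge_ereal_sup => _ [x [Wx fgx] <-]; apply: (le_trans fgx).
by apply: ereal_sup_ubound; exists x.
Qed.

Lemma limf_esup_lt_near (U : choiceType) (V : filteredType U) (F : set_system V)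
    (f : V -> \bar R) (c : \bar R) : Filter F ->
  limf_esup f F < c -> \forall x \near F, f x < c.
Proof.
move=> FF; rewrite limf_esupE => /ereal_inf_lt[_ [W FW <-]] Wc.
apply: filterS FW => x Wx; apply: le_lt_trans Wc.
by apply: ereal_sup_ubound; exists x.
Qed.

Lemma limf_esup_le_bound (U : choiceType) (V : filteredType U) (F : set_system V)
    (f : V -> \bar R) (c : \bar R) : Filter F ->
  (\forall x \near F, f x <= c) -> limf_esup f F <= c.
Proof.
move=> FF fc; rewrite limf_esupE.
apply: (@le_trans _ _ (ereal_sup (f @` [set x | f x <= c]))).
  by apply: ereal_inf_lbound; exists [set x | f x <= c].
by apply: ge_ereal_sup => _ [x fx <-].
Qed.

Lemma log_scale_gt0_near : \forall eps \near (0 : R)^'+, (0 < (ln eps^-1)^-1)%R.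
Proof.
near=> eps; rewrite invr_gt0 ln_gt0// invf_gt1; first by near: eps; exact: nbhs_right_lt.
by near: eps; exact: nbhs_right_gt.
Unshelve. all: by end_near. Qed.

Lemma le_log_scale_limsup (f g : R -> \bar R) :
  (forall eps, f eps <= g eps) -> log_scale_limsup f <= log_scale_limsup g.
Proof.
move=> fg; apply: limf_esup_le_near; apply: filterS log_scale_gt0_near => eps e0.
by apply: lee_wpmul2l => //; rewrite lee_fin ltW.
Qed.

(** Dilating the scale by 4 changes [ln eps^-1] by the constant [ln 4]; this and [C] are negligible
    against [ln eps^-1]. *)
Lemma log_scale_limsup_dilate (f g : R -> \bar R) (C : R) :
  (\forall eps \near (0 : R)^'+, f (4 * eps)%R <= g eps + C%:E) ->
  log_scale_limsup f <= log_scale_limsup g.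
Proof.
move=> fg.
have key (c d : R) : log_scale_limsup g < c%:E -> (0 < d)%R ->
    log_scale_limsup f <= (c + d)%:E.
  move=> /limf_esup_lt_near gc d0; apply: limf_esup_le_bound.
  have near4 (P : R -> Prop) : (\forall eps \near (0 : R)^'+, P eps) ->
      \forall eps \near (0 : R)^'+, P (eps / 4)%R.
    move=> [e /= e0 eP]; exists e => // x /= xe x0.
    apply: eP; rewrite /= ?divr_gt0//; apply: le_lt_trans xe.
    rewrite !sub0r !normrN normrM ler_piMr// ger0_norm ?invr_ge0//.
    by rewrite invf_le1// ler1n.
  have fg4 := near4 _ fg; have gc4 := near4 _ gc; have l4 := near4 _ log_scale_gt0_near.
  near=> eta.
  have eta0 : (0 < eta)%R by near: eta; exact: nbhs_right_gt.
  have fge : f (4 * (eta / 4))%R <= g (eta / 4)%R + C%:E by near: eta; exact: fg4.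
  have gce : (ln (eta / 4)^-1)^-1%:E * g (eta / 4)%R < c%:E by near: eta; exact: gc4.
  have l0 : (0 < (ln eta^-1)^-1)%R by near: eta; exact: log_scale_gt0_near.
  have l40 : (0 < (ln (eta / 4)^-1)^-1)%R by near: eta; exact: l4.
  have big : (c * ln 4 + C <= d * ln eta^-1)%R.
    rewrite lnV ?posrE// mulrN lerNr mulrC -ler_pdivlMr//.
    rewrite -ler_expR lnK ?posrE//; near: eta.
    by apply: nbhs_right_ltW; exact: expR_gt0.
  move: fge gce l40; rewrite (_ : 4 * (eta / 4) = eta)%R; last by rewrite mulrC divfK.
  have -> : ((eta / 4)^-1 = 4 * eta^-1)%R by rewrite invfM invrK mulrC.
  rewrite lnM ?posrE ?invr_gt0//.
  rewrite invr_gt0 in l0; move=> fge gce l40.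
  have ge : g (eta / 4)%R <= (c * (ln 4 + ln eta^-1))%:E.
    rewrite EFinM muleC -lee_pdivrMl//; exact: ltW.
  rewrite lee_pdivrMl//; apply: (le_trans fge).
  apply: (le_trans (leeD2r _ ge)); rewrite -EFinD -EFinM lee_fin.
  by rewrite mulrDr mulrDr [(_ * c)%R]mulrC [(_ * d)%R]mulrC; lra.
(* The bound by [c + d] settles a finite limit with [d] tending to 0, and the limit [-oo] with [c]
   arbitrary. *)
case: (log_scale_limsup g) key => [l| |] key; last 2 first.
- by rewrite leey.
- have {}key c : log_scale_limsup f <= c%:E.
    by have := key (c - 1)%R 1%R (ltNyr _) ltr01; rewrite subrK.
  case: (log_scale_limsup f) key => [l| |] key; last by [].
    by have := key (l - 1)%R; rewrite lee_fin lerBrDr gerDl ler10.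
  by have := key 0%R; rewrite leye_eq.
apply/lee_addgt0Pr => d d0.
have d20 : (0 < d / 2)%R by rewrite divr_gt0.
have := key (l + d / 2)%R (d / 2)%R; rewrite -addrA -splitr; apply => //.
by rewrite lte_fin ltrDl.
Unshelve. all: by end_near. Qed.

End limits_superior.

(** * Comparison of the spanning rate with the Katok entropies *)

Section FK_rates.
Context {R : realType} {X : pmetricType R} (T : X -> X).
Hypotheses (cptX : compact [set: X]) (hT : homeomorphism T).

Lemma Katok_number_ge1 (mu : probability (borelType X) R) n delta eps :
  delta < 1 -> (1 <= FK_Katok_number T mu n delta eps)%E.
Proof.
move=> d1; apply: le_ereal_inf_tmp => _ [E /= muE <-].
have [E0|/set0P[x Ex]] := eqVneq E set0.
  by move: muE; rewrite E0 bigcup_set0 measure0 lte_fin subr_lt0 ltNge (ltW d1).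
rewrite /counting; case: asboolP => [finE|_]; last by rewrite leey.
rewrite lee_fin ler1n cardfs_gt0; apply/fset0Pn; exists x.
by rewrite in_fset_set// inE.
Qed.

Lemma FK_Katok_entropy_ge0 (mu : probability (borelType X) R) eps delta :
  delta < 1 -> (0 <= FK_Katok_entropy T mu eps delta)%E.
Proof.
move=> d1; apply: limf_esup_ge0; first exact: filter_not_empty.
move=> n; apply: mule_ge0; first by rewrite lee_fin invr_ge0.
by rewrite lne_ge0 Katok_number_ge1.
Qed.

(** Ensures that the supremum over ergodic measures is not over the empty set, and so is
    nonnegative. *)
Lemma ergodic_measure_exists :
  exists mu : probability (borelType X) R, ergodic_measure T mu.
Proof.
have [|//|j|mu muT _] := @invariant_measure_of_frequency R X cptX T hT
  (fun=> setT) (fun=> point) S 1 (fun=> closedT).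
- by move=> ? ? _; exact/subsetPset.
- by have [_ _ _ ->] := empirical_content T (point : X) (ltn0Sn j).
have [|nu nuE _] := @ergodic_measure_closed R X cptX T hT setT mu 0 closedT muT.
  exact: measure_ge0.
by exists nu.
Qed.

Section net.
Context {A : finType} (net : A -> X) (eps : R).
Hypotheses (netP : forall x, exists a, mdist x (net a) < eps) (eps0 : 0 < eps)
  (cardA : #|A|%:R <= expR eps^-1).

(** The payoff of tame growth: the letters at unmatched times cost a bounded exponential rate,
    independent of [eps]. *)
Lemma card_pow_truncn n : #|A|%:R ^+ Num.truncn (eps * n%:R) <= expR n%:R :> R.
Proof.
set k := Num.truncn _; apply: (@le_trans _ _ (expR eps^-1 ^+ k)).
  by rewrite lerXn2r ?nnegrE// expR_ge0.
rewrite -expRM_natl ler_expR ler_pdivrMr// mulrC truncn_le.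
by rewrite mulr_ge0// ltW.
Qed.

Lemma coverable_of_Katok (mu : probability (borelType X) R) delta h :
  (FK_Katok_entropy T mu eps delta < h%:E)%E ->
  coverable T net (2 * eps) (expR h * 4 * expR 1) mu delta.
Proof.
move=> /limf_esup_lt_near[n0 _ n0P]; exists n0.+1.
(* The condition on [n] sits inside, so that a list, possibly junk, is chosen for every [n]. *)
suff /choice[W WP] n : exists W, (n0 < n)%N ->
    [/\ {in W, forall w : seq A, size w = n},
        (size W)%:R <= (expR h * 4 * expR 1) ^+ n &
        ((1 - delta)%:E <= mu [set x | has (matches T net (2 * eps) x) W])%E].
  by exists W.
have [n0n|_] := ltnP n0 n; last by exists [::].
have npos : (0 < n)%N by exact: leq_trans n0n.
have n0R : 0 < n%:R^-1 :> R by rewrite invr_gt0 ltr0n.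
have := n0P n (ltnW n0n); move=> /(lne_rate_lt n0R); rewrite invrK.
move=> /min_card_lt[s /= sP ssize].
have wP z := FK_ball_words T netP z npos erefl.
have [F FP] := choice wP.
exists (flatten [seq F z | z <- s]) => _; split.
- by move=> w /flatten_mapP[z _]; have [_ + _] := FP z; exact.
- rewrite size_flatten /shape -map_comp sumnE big_map.
  rewrite (eq_bigr (fun=> (4 ^ n * #|A| ^ Num.truncn (eps * n%:R))%N)); last first.
    by move=> z _; have [] := FP z.
  rewrite big_const_seq iter_addn_0 count_predT mulnC natrM !exprMn -mulrA.
  apply: ler_pM => //; first by apply: ltW; rewrite -expRM_natl.
  rewrite natrM !natrX; apply: ler_pM => //; rewrite ?exprn_ge0//.
  by rewrite -expRM_natl mulr1; exact: card_pow_truncn.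
- apply: (le_trans (ltW sP)); apply: le_measure; rewrite ?inE.
  + apply: sub_sigma_algebra; apply: bigcup_open => x _.
    by apply: open_FK_ball; case: hT.
  + exact: measurable_has_matches.
  + move=> y [z /= zs yz]; have [_ _ /(_ y yz)/hasP[w wF yw]] := FP z.
    by apply/hasP; exists w => //; apply/flatten_mapP; exists z.
Qed.

Lemma FK_spanning_number_le n (S : seq (seq A)) r : (0 < n)%N -> 0 < r ->
  {in S, forall w, size w = n} -> (forall x, has (matches T net r x) S) ->
  (FK_spanning_number T n (2 * r) <= (size S)%:R%:E)%E.
Proof.
move=> n0 r0 Sn Sx.
(* One representative per word; a word followed by no orbit gets an arbitrary point. *)
have /choice[c cP] w : exists y, forall x, matches T net r x w -> matches T net r y w.
  have [[y yw]|no] := pselect (exists y, matches T net r y w); first by exists y.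
  by exists point => x xw; case: no; exists x.
rewrite -(size_map c); apply: min_card_le => x.
have /hasP[w wS xw] := Sx x; exists (c w); first by apply/mapP; exists w.
rewrite -(Sn w wS); apply: (@FK_dist_matches _ _ _ _ net) => //; last exact: cP xw.
by rewrite Sn.
Qed.

(** Radii double twice: from FK balls to words, and from words back to FK distances. The constant
    collects [192 = 24 * 2 * 4], one unit from the factor [expR 1] in [a], and one unit spent on
    absorbing [c]. *)
Lemma FK_spanning_rate_le delta h : delta < 1 -> 0 <= h ->
  (forall mu : probability (borelType X) R, ergodic_measure T mu ->
    (FK_Katok_entropy T mu eps delta < h%:E)%E) ->
  (FK_spanning_rate T (4 * eps) <= (h + (2 + ln 192))%:E)%E.
Proof.
move=> d1 h0 ergh; set a := expR h * 4 * expR 1.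
have a1 : 1 <= a.
  have exp1 (x : R) : 0 <= x -> 1 <= expR x.
    by move=> x0; apply: le_trans (expR_ge1Dx x); rewrite lerDl.
  by rewrite /a !mulr_ege1 ?exp1 ?ler1n.
have eps2 : 0 < 2 * eps by rewrite mulr_gt0.
have netP2 x : exists b, mdist x (net b) < 2 * eps.
  by have [b xb] := netP x; exists b; apply: (lt_trans xb); lra.
have A0 : (0 < #|A|)%N by have [b _] := netP point; apply/card_gt0P; exists b.
pose e := (#|A|.*2)%N.
have e0 : (0 < e)%N by rewrite double_gt0.
have Ae : (#|A|.*2 <= 2 ^ e)%N by apply: ltnW; exact: ltn_expl.
have cov mu : ergodic_measure T mu -> coverable T net (2 * eps) a mu delta.
  by move=> /ergh; exact: coverable_of_Katok.
have [M [N0 MP]] := eventually_coded hT cptX a1 netP2 e0 d1 cov.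
have Z1 : 1 <= 2 * a by rewrite mulr_ege1// ler1n.
have [c cP] := block_code_span T netP2 Z1 Ae e0 M.
apply: limf_esup_le_bound.
(* The second bound gives [c <= N <= expR N]. *)
exists (maxn N0 (Num.truncn c).+1) => // N /=; rewrite geq_max => /andP[N0N cN].
have Npos : (0 < N)%N by exact: leq_trans cN.
have NR : 0 < N%:R^-1 :> R by rewrite invr_gt0 ltr0n.
have [S [Sc SN Scov]] := cP N.
apply: lne_rate_le => //; rewrite invrK.
have -> : 4 * eps = 2 * (2 * eps) by rewrite mulrA -natrM.
apply: (le_trans (FK_spanning_number_le Npos eps2 SN (fun x => Scov x (MP N x N0N)))).
rewrite lee_fin; apply: (le_trans Sc).
have cN' : c <= expR N%:R.
  apply: (@le_trans _ _ N%:R); last by apply: le_trans (expR_ge1Dx _); lra.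
  by apply: ltW; apply: (lt_le_trans (truncnS_gt c)); rewrite ler_nat.
have -> : expR (N%:R * (h + (2 + ln 192))) = expR N%:R * (24 * (2 * a)) ^+ N :> R.
  rewrite (_ : 24 * (2 * a) = expR (h + (1 + ln 192))).
    by rewrite -expRM_natl -expRD; congr expR; ring.
  by rewrite !expRD lnK ?posrE// /a; ring.
apply: ler_wpM2r => //; rewrite exprn_ge0//; lra.
Qed.

End net.

Lemma weak_tame_growth_net : weak_tame_growth X ->
  \forall eps \near (0 : R)^'+, exists (A : finType) (net : A -> X),
    (forall x, exists a, mdist x (net a) < eps) /\ #|A|%:R <= expR eps^-1.
Proof.
move=> growthX.
have lt1 : nbhs (0 : \bar R)%E [set y : \bar R | (y < 1)%E].
  by apply: open_nbhs_nbhs; split; [exact: open_ereal_lt_ereal|exact: lte01].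
have {lt1}growth1 := growthX _ lt1; near=> eps.
have eps0 : 0 < eps by near: eps; exact: nbhs_right_gt.
have : (eps%:E * lne (covering_number X eps) < 1)%E by near: eps; exact: growth1.
move=> /(lne_rate_lt eps0); rewrite mulr1 => /min_card_lt[s /= sT slt].
exists 'I_(size s), (fun i : 'I_(size s) => nth point s i); split; last by rewrite card_ord ltW.
move=> x; have [y ys] : (\bigcup_(z in [set` s]) ball z eps) x by rewrite sT.
rewrite ballEmdist /= => yx.
have iy : (index y s < size s)%N by rewrite index_mem.
by exists (Ordinal iy); rewrite /= nth_index// metric_sym.
Unshelve. all: by end_near. Qed.

Lemma FK_mdim_le_ergodic delta : weak_tame_growth X -> delta < 1 ->
  (FK_upper_mdim T <= FK_Katok_mdim T [set mu | ergodic_measure T mu] delta)%E.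
Proof.
move=> growthX d1; apply: (@log_scale_limsup_dilate _ _ _ (3 + ln 192)).
near=> eps.
have eps0 : 0 < eps by near: eps; exact: nbhs_right_gt.
have [A [net [netP cardA]]] : exists (A : finType) (net : A -> X),
    (forall x, exists a, mdist x (net a) < eps) /\ #|A|%:R <= expR eps^-1.
  by near: eps; exact: weak_tame_growth_net.
set s := ereal_sup _.
have ub (mu : probability (borelType X) R) : ergodic_measure T mu ->
    (FK_Katok_entropy T mu eps delta <= s)%E.
  by move=> muE; apply: ereal_sup_ubound; exists mu.
have s0 : (0 <= s)%E.
  have [mu muE] := ergodic_measure_exists.
  exact: le_trans (FK_Katok_entropy_ge0 _ _ d1) (ub mu muE).
(* For a finite supremum [u], the strict bound [u + 1] is used; the extra 1 turns the constant 2
   into 3. *)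
case: s s0 ub => [u| |] // u0 ub; last by rewrite leey.
rewrite lee_fin in u0.
have := @FK_spanning_rate_le A net eps netP eps0 cardA delta (u + 1) d1.
move=> /(_ (addr_ge0 u0 ler01)).
rewrite (_ : u + 1 + (2 + ln 192) = u + (3 + ln 192)); last by ring.
apply=> mu /ub ule; apply: (le_lt_trans ule).
by rewrite lte_fin ltrDl.
Unshelve. all: by end_near. Qed.

Lemma FK_Katok_mdim_le delta (M : set (probability (borelType X) R)) :
  0 < delta -> (FK_Katok_mdim T M delta <= FK_upper_mdim T)%E.
Proof.
move=> d0; apply: le_log_scale_limsup => eps.
apply: ge_ereal_sup => _ [mu _ <-]; apply: limf_esup_le_near.
apply: nearW => n; apply: lee_wpmul2l; first by rewrite lee_fin invr_ge0.
by apply: le_lne; exact: FK_Katok_le_spanning.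
Qed.

Lemma FK_Katok_mdim_subset delta (M N : set (probability (borelType X) R)) :
  M `<=` N -> (FK_Katok_mdim T M delta <= FK_Katok_mdim T N delta)%E.
Proof.
move=> MN; apply: le_log_scale_limsup => eps; apply: ereal_sup_le.
by move=> _ [mu Mmu <-]; exists mu => //; exact: MN.
Qed.

End FK_rates.

Theorem theorem1p2 (R : realType) (X : pmetricType R) (T : X -> X)
    (cptX : compact [set: X]) (homeoT : homeomorphism T)
    (growthX : weak_tame_growth X) (delta : R) (delta01 : 0 < delta < 1) :
  [/\ FK_upper_mdim T = FK_Katok_mdim T [set mu | ergodic_measure T mu] delta,
      FK_Katok_mdim T [set mu | ergodic_measure T mu] delta =
        FK_Katok_mdim T [set mu | invariant_measure T mu] delta &
      FK_Katok_mdim T [set mu | invariant_measure T mu] delta =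
        FK_Katok_mdim T [set: probability (borelType X) R] delta].
Proof.
have /andP[d0 d1] := delta01.
have erg := FK_mdim_le_ergodic cptX homeoT growthX d1.
have ei : (FK_Katok_mdim T [set mu | ergodic_measure T mu] delta <=
    FK_Katok_mdim T [set mu | invariant_measure T mu] delta)%E.
  by apply: FK_Katok_mdim_subset => mu [].
have ia : (FK_Katok_mdim T [set mu | invariant_measure T mu] delta <=
    FK_Katok_mdim T [set: probability (borelType X) R] delta)%E.
  by apply: FK_Katok_mdim_subset.
have top (M : set (probability (borelType X) R)) := FK_Katok_mdim_le T M d0.
(* The four quantities form a cycle of inequalities: mean dimension, ergodic, invariant and all
   measures, then mean dimension again. *)
split; apply/eqP; rewrite eq_le.
- by rewrite erg top.
- by rewrite ei (le_trans (top _) erg).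
- by rewrite ia (le_trans (top _) (le_trans erg ei)).
Qed.
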